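(* Let $F$ be a C-function with $F(\beta_0)=1$ and $\mathfrak{L}_F$ positive definite. Let $N,n,r\ge0$, let $\phi_{N+n}\in\mathcal{L}_{N+n}\setminus\{0\}$ with $\phi_{N+n}\perp_F\mathcal{L}_{N+n-1}$, and let $\psi_{N+n}$ be the rational function of the second kind of $\phi_{N+n}$. Suppose $\tilde\beta_r=\beta_N$. Assume that the self-reciprocal rational functions $A,B,C,D\in\mathcal{L}_N\cdot\tilde{\mathcal{L}}_r$ satisfy: $$\tau_A:=\frac{A^*(z)}{A(z)}=-\frac{B^*(z)}{B(z)}=-\frac{C^*(z)}{C(z)}=\frac{D^*(z)}{D(z)},\qquad\tau_A\in\mathbb{T};$$ $$B(\beta_j)\neq0,\quad j=0,\ldots,N-1,\qquad\text{if }N>0;$$ $$(A-BF)(z)=\zeta_0(z)B_{N-1}(z)g(z),\quad g\in H(\mathbb{D}),\quad\text{with } g(\beta)\neq0\text{ for }\beta\in\{\tilde\beta_0,\tilde\beta_1,\ldots,\tilde\beta_r,\hat\beta_1,\ldots,\hat\beta_n\};$$ $$(AD-BC)(z)=\zeta_0(z)B_{N-1}(z)\tilde\zeta_0(z)\tilde B_{r-1}(z)f(z),\quad f\in H(\mathbb{D})\setminus\{0\};$$ and that $$\tilde F(z)=\frac{-C(z)+D(z)F(z)}{A(z)-B(z)F(z)}$$ is a C-function with $\tilde F(\tilde\beta_0)=1$. Let $c_n\in\mathbb{R}\setminus\{0\}$ and define $$G_{r+n}=\frac{\phi_{N+n}A+\psi_{N+n}B}{c_nP_NB_N},\qquad J_{r+n}=\frac{\phi_{N+n}C+\psi_{N+n}D}{c_nP_NB_N},$$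 and suppose $G_{r+n}\neq0$ and $J_{r+n}\neq0$ (as functions). Then $G_{r+n}\perp_{\tilde F}\tilde{\mathcal{L}}_{r+n-1}$ (respectively $J_{r+n}\perp_{1/\tilde F}\tilde{\mathcal{L}}_{r+n-1}$), and $J_{r+n}$ (respectively $G_{r+n}$) is the function of the second kind of $G_{r+n}$ with respect to $\tilde F$ (respectively, of $J_{r+n}$ with respect to $1/\tilde F$).
   Context: Notation. $\mathbb{T}$ and $\mathbb{D}$ are the complex unit circle and open unit disc; $H(\mathbb{D})$ is the set of holomorphic functions on $\mathbb{D}$. The substar conjugate is $f_*(z)=\overline{f(1/\overline z)}$. For any sequence of points $\beta_0,\beta_1,\ldots$ in $\mathbb{D}$ put $\varpi_k(z)=1-\overline{\beta_k}z$, $\varpi_k^*(z)=z-\beta_k$, $\eta_k=\overline{\beta_k}/|\beta_k|$ if $\beta_k\neq0$ and $\eta_k=1$ if $\beta_k=0$, $\zeta_k=\eta_k\varpi_k^*/\varpi_k$, $B_{-1}=1/\zeta_0$, and $B_k=B_{k-1}\zeta_k$ for $k\ge0$ (so $B_0=1$). The associated spaces are $\mathcal{L}_{-1}=\{0\}$, $\mathcal{L}_0=\mathbb{C}$, $\mathcal{L}_k=\mathcal{L}\{\beta_1,\ldots,\beta_k\}=\{p/(\varpi_1\cdots\varpi_k): p \text{ a polynomial of degree}\le k\}$, and $\mathcal{L}=\bigcup_k\mathcal{L}_k$. Three families of points in $\mathbb{D}$ are given: $\beta_0,\ldots,\beta_N$; $\hat\beta_0,\hat\beta_1,\hat\beta_2,\ldots$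 with $\hat\beta_0=\beta_N$; and $\tilde\beta_0,\ldots,\tilde\beta_r$. Hats and tildes over $\zeta,B,\mathcal{L}$ mean that these are built from the corresponding family (in particular $\tilde B_{-1}=1/\tilde\zeta_0$). The first family is continued by $\beta_{N+j}:=\hat\beta_j$ ($j\ge1$), so that $B_{N+n}=B_N\hat B_n$ and $\mathcal{L}_{N+n}=\mathcal{L}\{\beta_1,\ldots,\beta_N,\hat\beta_1,\ldots,\hat\beta_n\}$; $\mathcal{L}_{N+n-1}=\mathcal{L}_N\cdot\hat{\mathcal{L}}_{n-1}$ if $n>0$, $=\mathcal{L}_{N-1}$ if $n=0$. Likewise $\tilde{\mathcal{L}}_{r+n}=\mathcal{L}\{\tilde\beta_1,\ldots,\tilde\beta_r,\hat\beta_1,\ldots,\hat\beta_n\}=\tilde{\mathcal{L}}_r\cdot\hat{\mathcal{L}}_n$, and $\tilde{\mathcal{L}}_{r+n-1}=\tilde{\mathcal{L}}_r\cdot\hat{\mathcal{L}}_{n-1}$ if $n>0$, $=\tilde{\mathcal{L}}_{r-1}$ if $n=0$. Superstar: for $f\in\mathcal{L}_N\cdot\tilde{\mathcal{L}}_r$, $f^*=B_N\tilde B_rf_*$. Self-reciprocal means $f^*=kf$ for some constant $k\in\mathbb{C}$. A C-function is an $F\in H(\mathbb{D})$ with $\Re F(z)>0$ on $\mathbb{D}$. For a base point $\beta_0$ put $D_0(t,z)=\dfrac{\zeta_0(t)+\zeta_0(z)}{\zeta_0(t)-\zeta_0(z)}$ (Riesz–Herglotz kernel). To a C-function $F$ with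 $F(\beta_0)=1$ corresponds the probability measure $\mu$ on $\mathbb{T}$ with $F(z)=\int_{\mathbb{T}}D_0(t,z)\,d\mu(t)$, and $\mathfrak{L}_F\{f\}=\int_{\mathbb{T}}f\,d\mu$; positive definite means $\mathfrak{L}_F\{ff_*\}>0$ for all $f\in\mathcal{L}\setminus\{0\}$. $f\perp_Fg$ means $\mathfrak{L}_F\{fg_*\}=0$. The function of the second kind of $\phi$ with respect to $F$ is $\psi(z)=\mathfrak{L}_F\{D_0(t,z)[\phi(t)-\phi(z)]\}+\mathfrak{L}_F\{\phi(t)\}$ ($\mathfrak{L}_F$ acting on $t$). For $\tilde F$ and $1/\tilde F$ all of this is understood with base point $\tilde\beta_0$, i.e. with $\zeta_0$ replaced by $\tilde\zeta_0$ in the kernel. $\tilde F$ is understood as a holomorphic function on $\mathbb{D}$, removable singularities being removed. $P_N(z)=\dfrac{\varpi_N(\beta_N)\,\varpi_0(z)\varpi_0^*(z)}{\varpi_0(\beta_0)\,\varpi_N(z)\varpi_N^*(z)}$. *)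

(* Defs.v *)
(* The complex plane is R[i] for R : realType. *)
From HB Require Import structures.
From mathcomp Require Import all_boot all_order all_algebra.
From mathcomp Require Import complex.
From mathcomp Require Import all_classical all_reals all_analysis.

Set Implicit Arguments.
Unset Strict Implicit.
Unset Printing Implicit Defensive.

Import Order.TTheory GRing.Theory Num.Theory.
Import numFieldNormedType.Exports.

Local Open Scope classical_set_scope.
Local Open Scope ring_scope.
Local Open Scope complex_scope.

(* Rational functions are elements of the fraction field of C[z], so that
   equality is equality of rational functions and removable singularities are
   removed. *)
Notation ratfun R := ({fraction {poly R[i]}}).

Local Notation "x %:F" := (@FracField.tofrac _ x).

(* Borel subsets of the complex plane. *)
Notation borelC R := (g_sigma_algebraType (@open R[i]^o)).

Section plane.
Context {R : realType}.
Notation C := R[i].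

Definition disc : set C := [set z | `|z| < 1].
Definition circle : set C := [set z | `|z| = 1].

(* R[i]^o is R[i] normed over itself, hence this is complex
   differentiability at every point of the disc. *)
Definition holomorphic_on_disc (f : C -> C) : Prop :=
  forall z, disc z -> derivable (f : C^o -> C^o) z 1.

Definition C_function (F : C -> C) : Prop :=
  holomorphic_on_disc F /\ (forall z, disc z -> 0 < complex.Re (F z)).

End plane.

Section rational_functions.
Context {R : realType}.
Notation C := R[i].

Definition ratC (c : C) : ratfun R := (c%:P)%:F.

(* The value of f at z: f = p / q is written with q(z) != 0; the value is 0 by
   convention if z is a pole of f. *)
Definition reval (f : ratfun R) (z : C) : C :=
  xget 0 [set v | exists p q : {poly C},
    [/\ q.[z] != 0, f = p%:F / q%:F & v = p.[z] / q.[z]]].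

Lemma reval_frac (p q : {poly C}) (z : C) :
  q.[z] != 0 -> reval (p%:F / q%:F) z = p.[z] / q.[z].
Proof.
have nz (s : {poly C}) : s.[z] != 0 -> s%:F != 0 :> ratfun R.
  by apply: contra_neq => /eqP; rewrite tofrac_eq0 => /eqP ->; rewrite horner0.
move=> qz; apply: xget_unique; first by exists p, q.
move=> _ [p' [q' [qz' e ->]]].
have /eqP := e; rewrite GRing.eqr_div ?nz// -!tofracM tofrac_eq => /eqP e'.
by apply/eqP; rewrite GRing.eqr_div// -!hornerM e'.
Qed.

Definition poly_substar (p : {poly C}) : ratfun R :=
  \sum_(i < size p) ratC (conjc p`_i) * ('X%:F)^-1 ^+ i.

(* f_*(z) is the conjugate of f(1 / conj z): conjugate the coefficients and
   substitute 1/z for z in the numerator and in the denominator. *)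
Definition substar (f : ratfun R) : ratfun R :=
  poly_substar (frac (repr f)).1 / poly_substar (frac (repr f)).2.

Definition varpi (b : C) : {poly C} := 1 - conjc b *: 'X.
Definition varpis (b : C) : {poly C} := 'X - b%:P.

Definition eta (b : C) : C := if b == 0 then 1 else conjc b / `|b|.

Definition zeta (b : C) : ratfun R :=
  ratC (eta b) * (varpis b)%:F / (varpi b)%:F.

(* B_k, and B_{k-1} with B_{-1} = 1 / zeta_0. *)
Definition blaschke (b : nat -> C) (k : nat) : ratfun R :=
  \prod_(1 <= j < k.+1) zeta (b j).
Definition blaschke_pred (b : nat -> C) (k : nat) : ratfun R :=
  if k is k'.+1 then blaschke b k' else (zeta (b 0%N))^-1.

(* L_k, and L_{k-1} with L_{-1} = {0}; the point b 0 is not a pole. *)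
Definition Lsp (b : nat -> C) (k : nat) : set (ratfun R) :=
  [set f | exists p : {poly C}, (size p <= k.+1)%N /\
     f = p%:F / (\prod_(1 <= j < k.+1) varpi (b j))%:F].
Definition Lsp_pred (b : nat -> C) (k : nat) : set (ratfun R) :=
  if k is k'.+1 then Lsp b k' else [set 0].

(* The product U . V = {u v} of two spaces; for spaces of the form L_k this is
   again a linear space since polynomials over C split. *)
Definition Lmul (U V : set (ratfun R)) : set (ratfun R) :=
  [set f | exists u v, [/\ U u, V v & f = u * v]].

(* The family b 0, ..., b N continued by bhat 1, bhat 2, ... *)
Definition continued (N : nat) (b bhat : nat -> C) (k : nat) : C :=
  if (k <= N)%N then b k else bhat (k - N)%N.

Definition superstar (b : nat -> C) (N : nat) (bt : nat -> C) (r : nat)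
    (f : ratfun R) : ratfun R :=
  blaschke b N * blaschke bt r * substar f.

Definition self_reciprocal (b : nat -> C) (N : nat) (bt : nat -> C) (r : nat)
    (f : ratfun R) : Prop :=
  exists k : C, superstar b N bt r f = ratC k * f.

Definition PN (b0 bN : C) : ratfun R :=
  ratC (varpi bN).[bN] * (varpi b0)%:F * (varpis b0)%:F
  / (ratC (varpi b0).[b0] * (varpi bN)%:F * (varpis bN)%:F).

End rational_functions.

Section functionals.
Context {R : realType}.
Notation C := R[i].

Definition kernelD (b0 t z : C) : C :=
  (reval (zeta b0) t + reval (zeta b0) z)
  / (reval (zeta b0) t - reval (zeta b0) z).

Definition cintegral (mu : probability (borelC R) R) (f : C -> C) : C :=
  (\int[mu]_(t in circle) complex.Re (f t))
  +i* (\int[mu]_(t in circle) complex.Im (f t)).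

(* mu is the probability measure on the circle that corresponds to the
   C-function F, with base point b0. *)
Definition herglotz (b0 : C) (F : C -> C) (mu : probability (borelC R) R) :
    Prop :=
  mu circle = 1%E /\
  (forall z, disc z -> F z = cintegral mu (fun t => kernelD b0 t z)).

Definition Lfun (mu : probability (borelC R) R) (f : ratfun R) : C :=
  cintegral mu (reval f).

(* In R[i], 0 < w means that w is real and positive. *)
Definition positive_definite (mu : probability (borelC R) R) (b : nat -> C) :
    Prop :=
  forall k f, Lsp b k f -> f != 0 -> 0 < Lfun mu (f * substar f).

Definition perp (mu : probability (borelC R) R) (f : ratfun R)
    (V : set (ratfun R)) : Prop :=
  forall g, V g -> Lfun mu (f * substar g) = 0.

(* psi is the rational function of the second kind of phi. A rational function
   is determined by its values on the disc; on the circle the formula is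
   singular at t = z, and at z = 1 / conj b0 zeta_0 has a pole. *)
Definition second_kind (mu : probability (borelC R) R) (b0 : C)
    (phi psi : ratfun R) : Prop :=
  forall z, disc z ->
    reval psi z =
      cintegral mu (fun t => kernelD b0 t z * (reval phi t - reval phi z))
      + Lfun mu phi.

End functionals.

(* Main.v *)
Require Import Defs.
From HB Require Import structures.
From mathcomp Require Import all_boot all_order all_algebra.
From mathcomp Require Import complex.
From mathcomp Require Import all_classical all_reals all_analysis.
From mathcomp Require Import measurable_realfun.
From mathcomp Require Import ring lra.

Set Implicit Arguments.
Unset Strict Implicit.
Unset Printing Implicit Defensive.

Import Order.TTheory GRing.Theory Num.Theory.
Import numFieldNormedType.Exports.

Local Open Scope classical_set_scope.
Local Open Scope ring_scope.
Local Open Scope complex_scope.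

Local Notation "x %:F" := (@FracField.tofrac _ x).

(** Only rational functions and Cauchy integrals occur, so continuity can replace
    holomorphy throughout: a rational function that agrees with a continuous
    function in a punctured neighbourhood of a point has no pole there
    (regular_around).

    Integrating the kernel D_0 against a rational phi gives, for z in the disc,
      phi F + psi = const (1 - conj beta_0 z) int (t - beta_0) phi(t) / (t - z) dmu.
    If phi is orthogonal to L_(k-1), Newton's divided differences of the right-hand
    side at beta_0, ..., beta_(k-1) vanish, hence phi F + psi is zeta_0 B_(k-1) times
    a continuous function (phi_factor). Reflecting the definition of psi in the
    circle changes the sign of the kernel, and phi^* F - psi^* is zeta_0 B_k times a
    continuous function (superstar_factor). The reflection requires the values of psi
    outside the disc, that is, the fact that the integral defining psi is a rational
    function (second_kind_exists).

    Conversely, these two factorizations near the points of the family, together with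
    the absence of poles in the closed disc, characterize the pair
    (perp_second_kind). The second one and Liouville's theorem for rational functions
    show that J is the function of the second kind of G; the first one then gives the
    zeros of a Cauchy integral and so orthogonality.

    It remains to transfer the factorizations from (phi, psi, F) to (G, J, tF). Since
    tF = (- C + D F) / (A - B F),
      (p A + s B) tF + (p C + s D) = (A D - B C) (p F + s) / (A - B F),
    and the hypotheses on A - B F and A D - B C exchange the zeros of
    zeta_0 B_(N-1) for those of the tilde family, up to the quotient f / g, which is
    continuous near the new points (transform_pair). This is applied to
    p = phi, s = psi and to p = phi^*, s = - psi^*, which produces G^* and - J^* up to
    the constant tau_A (substar_pair). That the new functions have no poles in
    the disc follows from p A + s B = p (A - B F) + B (p F + s) for G, and for J from
    Cramer's rule and the hypothesis on the zeros of B. For 1 / tF the same two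
    factorizations, divided by tF, hold with G and J exchanged. *)

(** * Rational functions: regular points, values, substar conjugation *)

Section regular.
Context {R : realType}.
Notation C := R[i].
Implicit Types (x y : ratfun R) (z a : C) (p q : {poly C}).

(** Excludes poles, where reval is 0 by convention and is no ring morphism. *)
Definition regular x z := exists p q, q.[z] != 0 /\ x = p%:F / q%:F.

Lemma horner_neq0 p z : p.[z] != 0 -> p != 0.
Proof. by apply: contra_neq => ->; rewrite horner0. Qed.

Lemma tofrac_neq0 p : p != 0 -> p%:F != 0 :> ratfun R.
Proof. by rewrite tofrac_eq0. Qed.

Lemma frac_eq p q p' q' : q != 0 -> q' != 0 ->
  p%:F / q%:F = p'%:F / q'%:F :> ratfun R -> p * q' = p' * q.
Proof.
move=> q0 q0' /eqP; rewrite GRing.eqr_div ?tofrac_neq0//.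
by rewrite -!tofracM tofrac_eq => /eqP.
Qed.

Lemma ratfun_repr x : x = (frac (repr x)).1%:F / (frac (repr x)).2%:F.
Proof.
rewrite -[in LHS](reprK x); move: (repr x) => y.
have d0 : (frac y).2 != 0 by case: y.
unlock FracField.tofrac.
rewrite -[X in _ = _ * X]FracField.pi_inv -[RHS]FracField.pi_mul.
rewrite /FracField.mulf /FracField.invf !(numden_Ratio, mul1r, mulr1)//
  ?oner_neq0//.
by rewrite Ratio_numden.
Qed.

(** Lowest terms make poles visible: see regular_coprime. *)
Lemma ratfun_coprime x :
  exists p q, [/\ q != 0, coprimep p q & x = p%:F / q%:F].
Proof.
have [u [v [v0 ->]]] : exists u v, v != 0 /\ x = u%:F / v%:F.
  exists (frac (repr x)).1, (frac (repr x)).2; split; last exact: ratfun_repr.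
  by case: (repr x).
exists (u %/ gcdp u v), (v %/ gcdp u v).
have g0 : gcdp u v != 0 by rewrite gcdp_eq0 negb_and v0 orbT.
have ev : v = v %/ gcdp u v * gcdp u v by rewrite divpK// dvdp_gcdr.
have eu : u = u %/ gcdp u v * gcdp u v by rewrite divpK// dvdp_gcdl.
have v0' : v %/ gcdp u v != 0.
  by apply: contra_neq v0 => e; rewrite ev e mul0r.
split => //; first by apply: coprimep_div_gcd; rewrite v0 orbT.
have -> : u%:F / v%:F = (u %/ gcdp u v * gcdp u v)%:F
    / (v %/ gcdp u v * gcdp u v)%:F :> ratfun R by rewrite -eu -ev.
by rewrite !tofracM GRing.invfM mulrACA divff ?mulr1// tofrac_neq0.
Qed.

Lemma regular_coprime p q z : q != 0 -> coprimep p q ->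
  regular (p%:F / q%:F) z -> q.[z] != 0.
Proof.
move=> q0 cpq [p' [q' [qz' /frac_eq e]]].
have := e q0 (horner_neq0 qz') => {}e.
have : q %| q' by rewrite -(Gauss_dvdpr _ (_ : coprimep q p)) 1?coprimep_sym//
  e dvdp_mull.
by move=> /dvdpP[w ew]; apply: contraNneq qz' => qz; rewrite ew hornerM qz mulr0.
Qed.

Lemma regular_poly p z : regular p%:F z.
Proof. by exists p, 1; rewrite hornerC oner_neq0 tofrac1 divr1. Qed.

Lemma reval_poly p z : reval p%:F z = p.[z].
Proof.
have := @reval_frac R p 1 z; rewrite hornerC tofrac1 !divr1; apply.
exact: oner_neq0.
Qed.

Lemma regular_ratC c z : regular (ratC c) z.
Proof. exact: regular_poly. Qed.

Lemma reval_ratC c z : reval (ratC c) z = c.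
Proof. by rewrite reval_poly hornerC. Qed.

Lemma fracD p q p' q' z : q.[z] != 0 -> q'.[z] != 0 ->
  p%:F / q%:F + p'%:F / q'%:F = (p * q' + p' * q)%:F / (q * q')%:F
    :> ratfun R.
Proof.
move=> /horner_neq0 q0 /horner_neq0 q0'.
by rewrite addf_div ?tofrac_neq0// tofracD !tofracM.
Qed.

Lemma fracM p q p' q' :
  (p%:F / q%:F) * (p'%:F / q'%:F) = (p * p')%:F / (q * q')%:F :> ratfun R.
Proof. by rewrite mulf_div !tofracM. Qed.

Lemma regularD x y z : regular x z -> regular y z -> regular (x + y) z.
Proof.
move=> [p [q [qz ->]]] [p' [q' [qz' ->]]]; rewrite (fracD _ _ qz qz').
by exists (p * q' + p' * q), (q * q'); rewrite hornerM mulf_neq0.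
Qed.

Lemma revalD x y z : regular x z -> regular y z ->
  reval (x + y) z = reval x z + reval y z.
Proof.
move=> [p [q [qz ->]]] [p' [q' [qz' ->]]]; rewrite (fracD _ _ qz qz').
by rewrite !reval_frac ?hornerM ?mulf_neq0// addf_div// hornerD !hornerM.
Qed.

Lemma regularM x y z : regular x z -> regular y z -> regular (x * y) z.
Proof.
move=> [p [q [qz ->]]] [p' [q' [qz' ->]]]; rewrite fracM.
by exists (p * p'), (q * q'); rewrite hornerM mulf_neq0.
Qed.

Lemma revalM x y z : regular x z -> regular y z ->
  reval (x * y) z = reval x z * reval y z.
Proof.
move=> [p [q [qz ->]]] [p' [q' [qz' ->]]]; rewrite fracM.
by rewrite !reval_frac ?hornerM ?mulf_neq0// mulf_div.
Qed.

Lemma regularN x z : regular x z -> regular (- x) z.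
Proof.
by move=> [p [q [qz ->]]]; rewrite -mulNr -tofracN; exists (- p), q.
Qed.

Lemma revalN x z : regular x z -> reval (- x) z = - reval x z.
Proof.
by move=> [p [q [qz ->]]]; rewrite -mulNr -tofracN !reval_frac// hornerN mulNr.
Qed.

Lemma regularV x z : regular x z -> reval x z != 0 -> regular x^-1 z.
Proof.
move=> [p [q [qz ->]]]; rewrite reval_frac// mulf_eq0 => /norP[pz _].
by rewrite invf_div; exists q, p.
Qed.

Lemma revalV x z : regular x z -> reval x z != 0 ->
  reval x^-1 z = (reval x z)^-1.
Proof.
move=> [p [q [qz ->]]]; rewrite reval_frac// mulf_eq0 => /norP[pz _].
by rewrite invf_div reval_frac// invf_div.
Qed.

Lemma regular_prod (I : Type) (s : seq I) (P : pred I) (X : I -> ratfun R) z :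
  (forall i, P i -> regular (X i) z) -> regular (\prod_(i <- s | P i) X i) z.
Proof.
move=> h; elim/big_ind : _ => //; last by move=> *; exact: regularM.
exact: regular_ratC 1 z.
Qed.

Lemma reval1 z : reval 1 z = 1 :> C.
Proof. exact: reval_ratC 1 z. Qed.

(** For all but finitely many points of the plane. Identities between rational
    functions are proved for almost all points, where nothing has a pole, and
    then extended by continuity. *)
Definition almost (P : C -> Prop) := exists s : seq C, forall z, z \notin s -> P z.

Lemma almost_and (P Q : C -> Prop) :
  almost P -> almost Q -> almost (fun z => P z /\ Q z).
Proof.
move=> [s hs] [t ht]; exists (s ++ t) => z; rewrite mem_cat => /norP[zs zt].
by split; [exact: hs|exact: ht].
Qed.

Lemma almost_mono (P Q : C -> Prop) :
  (forall z, P z -> Q z) -> almost P -> almost Q.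
Proof. by move=> PQ [s hs]; exists s => z /hs /PQ. Qed.

Lemma almost_reflect (P : C -> Prop) :
  almost P -> almost (fun z => P (conjc z)^-1).
Proof.
move=> [s hs]; exists [seq (conjc z)^-1 | z <- s] => z zs; apply: hs.
apply: contraNN zs => zs; apply/mapP; exists (conjc z)^-1 => //.
by rewrite fmorphV/= conjcK invrK.
Qed.

Lemma poly_split p :
  exists s : seq C, p = lead_coef p *: \prod_(a <- s) ('X - a%:P).
Proof. by have [s e] := closed_field_poly_normal p; exists s. Qed.

Lemma almost_poly p : p != 0 -> almost (fun z => p.[z] != 0).
Proof.
move=> p0; have [s e] := poly_split p; exists s => z zs.
have : ~~ root p z by rewrite e rootZ ?lead_coef_eq0// root_prod_XsubC.
by [].
Qed.

Lemma almost_neq a : almost (fun z => z != a).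
Proof. by exists [:: a] => z; rewrite inE. Qed.

Lemma almost_regular x : almost (regular x).
Proof.
have [p [q [q0 _ ->]]] := ratfun_coprime x.
by apply: almost_mono (almost_poly q0) => z qz; exists p, q.
Qed.

Lemma almost_neq0 x : x != 0 -> almost (fun z => reval x z != 0).
Proof.
have [p [q [q0 _ ->]]] := ratfun_coprime x => x0.
have p0 : p != 0 by apply: contra_neq x0 => ->; rewrite tofrac0 mul0r.
apply: almost_mono (almost_and (almost_poly q0) (almost_poly p0)) => z [qz pz].
by rewrite reval_frac// mulf_neq0// invr_eq0.
Qed.

End regular.

(** Regularity of expressions whose leaves are known to be regular. *)
Ltac reg := repeat match goal with
  | H : ?P |- ?P => exact: H
  | |- regular (_ + _) _ => apply: regularD
  | |- regular (_ * _) _ => apply: regularM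
  | |- regular (- _) _ => apply: regularN
  | |- regular (ratC _) _ => exact: regular_ratC
  | |- regular (FracField.tofrac _) _ => exact: regular_poly
  end.

Section substar.
Context {R : realType}.
Notation C := R[i].
Implicit Types (x y : ratfun R) (z a : C) (p q : {poly C}).

Lemma ratC_zmod : zmod_morphism (@ratC R).
Proof. by move=> a b; rewrite /ratC polyCB tofracB. Qed.
Lemma ratC_monoid : monoid_morphism (@ratC R).
Proof. by split => [//|a b]; rewrite /ratC polyCM tofracM. Qed.
HB.instance Definition _ :=
  GRing.isZmodMorphism.Build C (ratfun R) (@ratC R) ratC_zmod.
HB.instance Definition _ :=
  GRing.isMonoidMorphism.Build C (ratfun R) (@ratC R) ratC_monoid.

Lemma ratC_neq0 (c : C) : c != 0 -> ratC c != 0.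
Proof. by rewrite fmorph_eq0. Qed.

(** Evaluation of the conjugate polynomial at 1 / 'X: a ring morphism, which is
    why substar is a field automorphism. *)
Lemma poly_substarE p :
  poly_substar p = (map_poly (@ratC R) (map_poly conjc p)).['X%:F^-1].
Proof.
rewrite -(map_poly_comp (@ratC R) conjc).
rewrite horner_poly; apply: eq_bigr => i _ //=.
Qed.

Lemma poly_substarD p q : poly_substar (p + q) = poly_substar p + poly_substar q.
Proof. by rewrite !poly_substarE !rmorphD hornerD. Qed.

Lemma poly_substarM p q : poly_substar (p * q) = poly_substar p * poly_substar q.
Proof. by rewrite !poly_substarE !rmorphM hornerM. Qed.

Lemma reval_poly_substar p z : z != 0 ->
  regular (poly_substar p) z /\ reval (poly_substar p) z = conjc p.[(conjc z)^-1].
Proof.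
move=> z0.
elim/poly_ind : p => [|p c [rp ep]].
  rewrite /poly_substar size_poly0 big_ord0 horner0 rmorph0.
  by split; [exact: regular_ratC 0 z|exact: reval_ratC 0 z].
rewrite poly_substarD poly_substarM.
have eX : poly_substar 'X = ('X%:F)^-1 :> ratfun R.
  by rewrite poly_substarE !map_polyX hornerX.
have rX : regular (('X%:F)^-1 : ratfun R) z.
  by apply: regularV; [reg|rewrite reval_poly hornerX].
have eC : poly_substar c%:P = ratC (conjc c).
  by rewrite poly_substarE !map_polyC hornerC.
rewrite eX eC; split; first by reg.
rewrite revalD; [|by reg..]; rewrite revalM; [|by reg..].
rewrite ep reval_ratC revalV ?reval_poly ?hornerX//; last by reg.
by rewrite !hornerE rmorphD rmorphM fmorphV/= conjcK.
Qed.

Lemma poly_substar_neq0 p : p != 0 -> poly_substar p != 0.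
Proof.
move=> p0; have [s hs] := almost_and (almost_reflect (almost_poly p0))
  (almost_neq 0).
(* A point outside a finite set: larger than the sum of the moduli. *)
have [z zs] : exists z : C, z \notin s.
  exists (\sum_(a <- s) `|a| + 1); apply/negP => /= zs.
  have : \sum_(a <- s) `|a| + 1 <= \sum_(a <- s) `|a| :> C.
    rewrite [leRHS](big_rem _ zs)/= ger0_norm ?lerDl ?sumr_ge0//.
    by rewrite addr_ge0// sumr_ge0.
  by rewrite gerDl ler10.
have [pz z0] := hs _ zs.
apply: contra_neq pz => e.
have [_] := reval_poly_substar p z0.
by rewrite e (reval_ratC 0 z) => /esym/eqP; rewrite fmorph_eq0 => /eqP.
Qed.

Lemma substar_frac p q : q != 0 ->
  substar (p%:F / q%:F) = poly_substar p / poly_substar q.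
Proof.
move=> q0; rewrite /substar; set x := p%:F / q%:F.
have d0 : (frac (repr x)).2 != 0 by case: (repr x).
have /(frac_eq q0 d0) e := ratfun_repr x.
apply/eqP; rewrite GRing.eqr_div ?poly_substar_neq0//.
by rewrite -!poly_substarM e.
Qed.

Lemma substar_poly p : substar p%:F = poly_substar p.
Proof.
have := @substar_frac p 1 (oner_neq0 _); rewrite tofrac1 divr1 => ->.
rewrite [X in _ / X](_ : _ = 1) ?divr1//.
by rewrite poly_substarE !rmorph1 hornerC.
Qed.

Lemma substar_ratC (c : C) : substar (ratC c) = ratC (conjc c).
Proof. by rewrite substar_poly poly_substarE !map_polyC hornerC. Qed.

Lemma substarM x y : substar (x * y) = substar x * substar y.
Proof.
have [p [q [q0 _ ->]]] := ratfun_coprime x.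
have [p' [q' [q0' _ ->]]] := ratfun_coprime y.
by rewrite fracM !substar_frac ?mulf_neq0// !poly_substarM mulf_div.
Qed.

Lemma substarD x y : substar (x + y) = substar x + substar y.
Proof.
have [p [q [q0 _ ->]]] := ratfun_coprime x.
have [p' [q' [q0' _ ->]]] := ratfun_coprime y.
rewrite addf_div ?tofrac_neq0// -!tofracM -tofracD.
rewrite !substar_frac ?mulf_neq0// addf_div ?poly_substar_neq0//.
by rewrite poly_substarD !poly_substarM.
Qed.

Lemma substar0 : substar 0 = 0 :> ratfun R.
Proof. by have := substar_ratC (0 : C); rewrite !rmorph0. Qed.

Lemma substar1 : substar 1 = 1 :> ratfun R.
Proof. by have := substar_ratC (1 : C); rewrite !rmorph1. Qed.

Lemma substarV x : substar x^-1 = (substar x)^-1.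
Proof.
have [->|x0] := eqVneq x 0; first by rewrite invr0 substar0 invr0.
have s0 : substar x != 0.
  have [p [q [q0 _ e]]] := ratfun_coprime x; rewrite e in x0 *.
  have p0 : p != 0 by apply: contra_neq x0 => ->; rewrite tofrac0 mul0r.
  rewrite (substar_frac _ q0) mulf_eq0 invr_eq0 negb_or.
  by apply/andP; split; exact: poly_substar_neq0.
by apply: (mulfI s0); rewrite -substarM (divff x0) (divff s0) substar1.
Qed.

Lemma substarN x : substar (- x) = - substar x.
Proof.
by rewrite -mulN1r -(rmorphN1 (@ratC R)) substarM substar_ratC !rmorphN1 mulN1r.
Qed.

Lemma substar_prod (I : Type) (s : seq I) (P : pred I) (X : I -> ratfun R) :
  substar (\prod_(i <- s | P i) X i) = \prod_(i <- s | P i) substar (X i).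
Proof. exact: (big_morph _ substarM substar1). Qed.

(** The algebraic substar conjugate has the values conj (x (1 / conj z)). *)
Lemma reval_substar x z : z != 0 -> regular x (conjc z)^-1 ->
  regular (substar x) z /\ reval (substar x) z = conjc (reval x (conjc z)^-1).
Proof.
move=> z0 [p [q [qz ->]]].
have [rp ep] := reval_poly_substar p z0.
have [rq eq] := reval_poly_substar q z0.
have nq : reval (poly_substar q) z != 0 by rewrite eq fmorph_eq0.
rewrite substar_frac ?(horner_neq0 qz)//; split.
  by apply: regularM => //; apply: regularV.
by rewrite revalM ?revalV//; [rewrite ep eq reval_frac// rmorphM fmorphV|exact: regularV].
Qed.

End substar.

(** * Continuity in the plane and punctured neighbourhoods *)

Section continuity.
Context {R : realType}.
Notation C := R[i].
Implicit Types (x y : ratfun R) (z a : C) (p q : {poly C}) (f g u : C -> C).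

(** Continuity at z for the topology of R[i]^o, the one that underlies
    holomorphic_on_disc. *)
Definition cont f z := {for (z : C^o), continuous (f : C^o -> C^o)}.

(** A punctured neighbourhood avoids any finite set, whether or not z itself is
    exceptional. *)
Definition around z (P : C -> Prop) := \forall w \near (z : C^o)^', P w.

Lemma around_and z (P Q : C -> Prop) :
  around z P -> around z Q -> around z (fun w => P w /\ Q w).
Proof. exact: filterI. Qed.

Lemma around_mono z (P Q : C -> Prop) :
  (forall w, P w -> Q w) -> around z P -> around z Q.
Proof. by move=> PQ; apply: filterS. Qed.

Lemma around_all z (P : C -> Prop) : (forall w, P w) -> around z P.
Proof. exact: filterE. Qed.

Lemma around_ex z (P : C -> Prop) : around z P -> exists w, P w.
Proof. exact: filter_ex. Qed.

Lemma around_neq z : around z (fun w => w != z).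
Proof. exact: nbhs_dnbhs_neq. Qed.

Lemma around_nbhs z (P : C -> Prop) :
  (\forall w \near (z : C^o), P w) -> around z P.
Proof. exact: nbhs_dnbhs. Qed.

Lemma cont_neq0 f z : cont f z -> f z != 0 -> \forall w \near (z : C^o), f w != 0.
Proof.
move=> cf f0; apply: (cf [set w | w != 0]).
apply/(@nbhs_ballP _ C^o); exists `|f z|; first by rewrite /= normr_gt0.
by move=> w; apply: contraTneq => ->; rewrite /ball/= subr0 ltxx.
Qed.

Lemma around_neq0 f z : cont f z -> f z != 0 -> around z (fun w => f w != 0).
Proof. by move=> cf f0; apply: around_nbhs; exact: cont_neq0. Qed.

Lemma cont_cst a z : cont (fun=> a) z.
Proof. exact: cst_continuous. Qed.

Lemma cont_id z : cont id z.
Proof. exact: cvg_id. Qed.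

Lemma contD f g z : cont f z -> cont g z -> cont (fun w => f w + g w) z.
Proof. by move=> cf cg; exact: (cvgD cf cg). Qed.

Lemma contN f z : cont f z -> cont (fun w => - f w) z.
Proof. by move=> cf; exact: (cvgN cf). Qed.

Lemma contB f g z : cont f z -> cont g z -> cont (fun w => f w - g w) z.
Proof. by move=> cf cg; exact: (cvgB cf cg). Qed.

Lemma contM f g z : cont f z -> cont g z -> cont (fun w => f w * g w) z.
Proof. by move=> cf cg; exact: (cvgM cf cg). Qed.

Lemma contV f z : cont f z -> f z != 0 -> cont (fun w => (f w)^-1) z.
Proof. by move=> cf f0; exact: (cvgV f0 cf). Qed.

End continuity.

(** Continuity of algebraic expressions; leaves denominators and unknown
    functions as goals. *)
Ltac conts := repeat match goal with
  | H : cont ?f ?z |- cont ?f ?z => exact H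
  | |- cont (fun w => @?f w + - @?g w) ?z => apply (@contB _ f g z)
  | |- cont (fun w => @?f w + @?g w) ?z => apply (@contD _ f g z)
  | |- cont (fun w => - @?f w) ?z => apply (@contN _ f z)
  | |- cont (fun w => @?f w * @?g w) ?z => apply (@contM _ f g z)
  | |- cont (fun w => w) ?z => exact (@cont_id _ z)
  | |- cont (fun w => ?c) ?z => exact (@cont_cst _ c z)
  | |- cont (fun w => (@?f w)^-1) ?z => apply (@contV _ f z)
  | |- cont (fun w => ?f w) ?z => change (cont f z)
  end.

Section isolated_points.
Context {R : realType}.
Notation C := R[i].
Implicit Types (x y : ratfun R) (z a : C) (p q : {poly C}) (f g u : C -> C).

Lemma cont_prod (I : Type) (s : seq I) (F : I -> C -> C) z :
  (forall i, cont (F i) z) -> cont (fun w => \prod_(i <- s) F i w) z.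
Proof.
move=> h; elim: s => [|i s ih].
  rewrite (_ : (fun w => _) = fun=> 1); first exact: cont_cst.
  by apply/funext => w; rewrite big_nil.
rewrite (_ : (fun w => _) = (fun w => F i w * \prod_(i <- s) F i w)).
  by conts; exact: h.
by apply/funext => w; rewrite big_cons.
Qed.

Lemma cont_near f g z :
  (\forall w \near (z : C^o), f w = g w) -> cont f z -> cont g z.
Proof.
move=> fg cf; have e : f z = g z := nbhs_singleton fg.
have : f w @[w --> (z : C^o)] --> (f z : C^o) by exact: cf.
by rewrite e => {}cf; exact: cvg_trans (near_eq_cvg fg) cf.
Qed.

Lemma cont_poly p z : cont (horner p) z.
Proof.
elim/poly_ind: p => [|p c ih].
  rewrite (_ : horner 0 = fun=> 0); first exact: cont_cst.
  by apply/funext => w; rewrite horner0.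
rewrite (_ : horner _ = fun w => p.[w] * w + c).
  by conts.
by apply/funext => w; rewrite !hornerE.
Qed.

Lemma cont_reval x z : regular x z -> cont (reval x) z.
Proof.
move=> [p [q [qz ->]]].
apply: (@cont_near (fun w => p.[w] / q.[w])).
  near=> w; rewrite reval_frac//; near: w.
  by apply: cont_neq0 => //; exact: cont_poly.
by conts => //; exact: cont_poly.
Unshelve. all: by end_near. Qed.

Lemma around_almost z (P : C -> Prop) : almost P -> around z P.
Proof.
move=> [s hs]; have : around z (fun w => w \notin s); last exact: around_mono.
elim: s {hs} => [|a s ih]; first exact: around_all.
apply: around_mono (around_and ih (_ : around z (fun w => w != a))).
  by move=> w []; rewrite inE negb_or => -> ->.
have [->|az] := eqVneq a z; first exact: around_neq.
have za : z - a != 0 by rewrite subr_eq0 eq_sym.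
have cza : cont (fun w => w - a) z by conts.
by apply: around_mono (around_neq0 cza za) => w; rewrite subr_eq0.
Qed.

Lemma cont_eq f g z : cont f z -> cont g z ->
  around z (fun w => f w = g w) -> f z = g z.
Proof.
move=> /(continuous_withinNx (f : C^o -> C^o)) cf.
move=> /(continuous_withinNx (g : C^o -> C^o)) cg fg.
have {}fg : \forall w \near (z : C^o)^', f w = g w by exact: fg.
have gf : g w @[w --> (z : C^o)^'] --> (f z : C^o).
  exact: cvg_trans (near_eq_cvg fg) cf.
exact: (@cvg_unique C^o (@norm_hausdorff _ _) _ _ _ _ gf cg).
Qed.

(** A pole cannot be hidden in a punctured neighbourhood: if x = p / q is in
    lowest terms and q vanishes at z, then p = u q around z with u continuous
    forces p to vanish at z as well. *)
Lemma regular_around x u z : cont u z ->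
  around z (fun w => reval x w = u w) -> regular x z /\ reval x z = u z.
Proof.
move=> cu xu; have rx : regular x z; last first.
  by split=> //; exact: cont_eq (cont_reval rx) cu xu.
have [p [q [q0 cpq e]]] := ratfun_coprime x.
have epq : p.[z] = u z * q.[z].
  apply: (@cont_eq (horner p) (fun w => u w * q.[w])).
  - exact: cont_poly.
  - by conts; exact: cont_poly.
  apply: around_mono (around_and xu (around_almost z (almost_poly q0))).
  by move=> w [<- qw]; rewrite e reval_frac// divfK.
exists p, q; split => //; apply: contraTneq cpq => qz.
have pz : root p z by rewrite /root epq qz mulr0.
apply/negP => /coprimepP /(_ ('X - z%:P)).
rewrite !dvdp_XsubCl pz /root qz eqxx => /(_ isT isT).
by move=> /eqp_size; rewrite size_XsubC size_poly1.
Qed.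

Lemma around_regular x z : around z (regular x).
Proof. exact/around_almost/almost_regular. Qed.

Lemma ratfun_ext x y z : around z (fun w => reval x w = reval y w) -> x = y.
Proof.
move=> xy; apply/eqP; rewrite -subr_eq0; apply/negPn/negP => d0.
have [w [[[e rx] ry]]] := around_ex (around_and (around_and (around_and xy
  (around_regular x z)) (around_regular y z))
  (around_almost z (almost_neq0 d0))).
by rewrite revalD ?revalN//; [rewrite e subrr eqxx|exact: regularN].
Qed.

Lemma disc_near z : disc z -> \forall w \near (z : C^o), disc w.
Proof.
move=> dz; apply/(@nbhs_ballP _ C^o); exists (1 - `|z|).
  by rewrite /= subr_gt0.
move=> w; rewrite /ball/= /disc/= => h.
rewrite -(subrK z w) (le_lt_trans (ler_normD _ _))// -ltrBrDr.
by rewrite distrC.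
Qed.

Lemma holomorphic_cont f z : holomorphic_on_disc f -> disc z -> cont f z.
Proof.
by move=> hf /hf /derivable1_diffP; exact: differentiable_continuous.
Qed.

End isolated_points.

(** * Integrals of bounded measurable functions over the circle *)

Section integral.
Context {R : realType}.
Notation C := R[i].
Notation Re := (@complex.Re R).
Notation Im := (@complex.Im R).
Implicit Types (f g h : C -> C) (z a c : C) (M : R).

Lemma normc_ge_Im (z : C) : `|Im z|%:C <= `|z|.
Proof.
by rewrite normc_def lecR -sqrtr_sqr ler_wsqrtr// lerDr sqr_ge0.
Qed.

Lemma open_measurableC (U : set C) : open (U : set C^o) ->
  measurable (U : set (borelC R)).
Proof. by move=> oU; apply: sub_sigma_algebra. Qed.

Lemma measurable_circle : measurable (circle : set (borelC R)).
Proof.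
rewrite -[circle]setCK; apply: measurableC; apply: open_measurableC.
rewrite openE => z /= z1; apply/(@nbhs_ballP _ C^o).
exists `|1 - `|z| |.
  by rewrite /= normr_gt0 subr_eq0 eq_sym; apply/eqP.
move=> w; rewrite /ball/= => h w1.
have := le_lt_trans (ler_dist_dist z w) h.
by rewrite w1 distrC ltxx.
Qed.

(** Meant for the real and the imaginary part: preimages of open half-lines are
    open. *)
Lemma measurable_lipschitz (L : C -> R) :
  (forall z w, `|L z - L w|%:C <= `|z - w|) ->
  measurable_fun (circle : set (borelC R)) (L : borelC R -> R).
Proof.
move=> lip; apply: (@measurable_funS _ _ _ _ setT) => //.
apply: (measurability _ (RGenOInfty.measurableE R)).
move=> _ [_ [a ->] <-]; rewrite setTI; apply: open_measurableC.
rewrite openE => z /=; rewrite in_itv/= andbT => az.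
apply/(@nbhs_ballP _ C^o).
exists (L z - a)%:C; first by rewrite /= ltcR subr_gt0.
move=> w; rewrite /ball/= in_itv/= andbT => h.
have := le_lt_trans (lip z w) h.
by rewrite ltcR => /(le_lt_trans (ler_norm _)); rewrite ltrD2l ltrN2.
Qed.

Lemma ReB z w : Re (z - w) = Re z - Re w. Proof. by case: z w => ? ? [? ?]. Qed.
Lemma ImB z w : Im (z - w) = Im z - Im w. Proof. by case: z w => ? ? [? ?]. Qed.

(** Measurable and bounded on the circle. All integrands below are of this
    kind, so that the integral, which is total, is linear on them. *)
Definition bmeas f :=
  [/\ measurable_fun (circle : set (borelC R)) (fun t : borelC R => Re (f t)),
      measurable_fun (circle : set (borelC R)) (fun t : borelC R => Im (f t)) &
      exists M, forall t, circle t -> `|f t| <= M%:C].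

Lemma bmeas_ext f g : (forall t, circle t -> f t = g t) -> bmeas f -> bmeas g.
Proof.
move=> fg [mr mi [M hM]]; split.
- by apply: eq_measurable_fun mr => t /[!inE] /fg ->.
- by apply: eq_measurable_fun mi => t /[!inE] /fg ->.
- by exists M => t ct; rewrite -fg// hM.
Qed.

Lemma bmeas_cst c : bmeas (fun=> c).
Proof.
split; [exact: measurable_cst|exact: measurable_cst|].
by exists (Re `|c|) => t _; rewrite RRe_real// normr_real.
Qed.

Lemma bmeas_id : bmeas id.
Proof.
split.
- by apply: measurable_lipschitz => z w; rewrite -ReB normc_ge_Re.
- by apply: measurable_lipschitz => z w; rewrite -ImB normc_ge_Im.
- by exists 1 => t ->.
Qed.

Lemma bmeasD f g : bmeas f -> bmeas g -> bmeas (fun t => f t + g t).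
Proof.
move=> [mr mi [M hM]] [mr' mi' [M' hM']]; split.
- apply: eq_measurable_fun (measurable_funD mr mr') => t _ /=.
  by case: (f t) (g t) => ? ? [].
- apply: eq_measurable_fun (measurable_funD mi mi') => t _ /=.
  by case: (f t) (g t) => ? ? [].
- exists (M + M') => t ct; rewrite rmorphD (le_trans (ler_normD _ _))//.
  by rewrite lerD ?hM ?hM'.
Qed.

Lemma bmeasM f g : bmeas f -> bmeas g -> bmeas (fun t => f t * g t).
Proof.
move=> [mr mi [M hM]] [mr' mi' [M' hM']]; split.
- apply: eq_measurable_fun (measurable_funB (measurable_funM mr mr')
    (measurable_funM mi mi')) => t _ /=.
  by case: (f t) (g t) => ? ? [].
- apply: eq_measurable_fun (measurable_funD (measurable_funM mr mi')
    (measurable_funM mi mr')) => t _ /=.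
  by case: (f t) (g t) => ? ? [].
- by exists (M * M') => t ct; rewrite rmorphM normrM ler_pM ?hM ?hM'.
Qed.

Lemma bmeasN f : bmeas f -> bmeas (fun t => - f t).
Proof.
move=> mf; apply: bmeas_ext (bmeasM (bmeas_cst (-1)) mf) => t _.
by rewrite mulN1r.
Qed.

Lemma bmeasJ f : bmeas f -> bmeas (fun t => conjc (f t)).
Proof.
move=> [mr mi [M hM]]; split.
- by apply: eq_measurable_fun mr => t _ /=; case: (f t).
- by apply: eq_measurable_fun (measurable_funN mi) => t _ /=; case: (f t).
- by exists M => t ct; rewrite normcJ hM.
Qed.

(** The reciprocal is the conjugate over the squared modulus, and the real
    function `^ (-1) is measurable. *)
Lemma bmeasV f d : 0 < d -> (forall t, circle t -> d%:C <= `|f t|) ->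
  bmeas f -> bmeas (fun t => (f t)^-1).
Proof.
move=> d0 hd [mr mi _].
pose n (t : borelC R) := Re (f t) * Re (f t) + Im (f t) * Im (f t).
have mn : measurable_fun (circle : set (borelC R)) (fun t => n t `^ (-1)).
  have mn : measurable_fun (circle : set (borelC R)) n.
    exact: (measurable_funD
      (measurable_funM mr mr)
      (measurable_funM mi mi)).
  exact: (measurableT_comp (measurable_powR (-1)) mn).
have n0 t : 0 <= n t by rewrite addr_ge0// -expr2 sqr_ge0.
split.
- apply: eq_measurable_fun (measurable_funM mr mn) => t _ /=.
  by rewrite powR_inv1// /n; case: (f t) => a b /=; rewrite -!expr2.
- apply: eq_measurable_fun (measurable_funN (measurable_funM mi mn)) => t _ /=.
  by rewrite powR_inv1// /n; case: (f t) => a b /=; rewrite -!expr2.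
- exists d^-1 => t ct.
  have f0 : 0 < `|f t| by apply: (lt_le_trans _ (hd _ ct)); rewrite ltcR.
  by rewrite normfV fmorphV lef_pV2 ?hd// posrE// ltcR.
Qed.

Section fixed_measure.
Variable mu : probability (borelC R) R.
Hypothesis mu1 : mu circle = 1%E.

Lemma bounded_integrable (f : borelC R -> R) M :
  measurable_fun (circle : set (borelC R)) f -> (forall t, circle t -> `|f t| <= M) ->
  mu.-integrable circle (EFin \o f).
Proof.
move=> mf fM; apply: measurable_bounded_integrable => //.
- exact: measurable_circle.
- have h : (mu circle < +oo)%E by rewrite mu1 ltry.
  exact: h.
- exists M; split; first exact: num_real.
  by move=> x Mx t ct; rewrite /= (le_trans (fM _ ct))// ltW.
Qed.

Lemma integrable_scale (k : R) (u : borelC R -> R) :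
  mu.-integrable circle (EFin \o u) ->
  mu.-integrable circle (EFin \o (fun t => k * u t)).
Proof.
move=> iu; have mc := measurable_circle.
by apply: eq_integrable (integrableZl mc k iu) => // t _; rewrite /= EFinM.
Qed.

Lemma bmeas_integrable f : bmeas f ->
  mu.-integrable circle (EFin \o (fun t : borelC R => Re (f t))) /\
  mu.-integrable circle (EFin \o (fun t : borelC R => Im (f t))).
Proof.
move=> [mr mi [M hM]]; split.
- apply: bounded_integrable mr _ => t /hM h.
  by rewrite -lecR; exact: le_trans (normc_ge_Re _) h.
- apply: bounded_integrable mi _ => t /hM h.
  by rewrite -lecR; exact: le_trans (normc_ge_Im _) h.
Qed.

Local Notation cint := (cintegral mu).

Lemma cint_ext f g : (forall t, circle t -> f t = g t) -> cint f = cint g.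
Proof.
by move=> fg; congr (_ +i* _); apply: eq_Rintegral => t /[!inE] /fg ->.
Qed.

Lemma cintD f g : bmeas f -> bmeas g ->
  cint (fun t => f t + g t) = cint f + cint g.
Proof.
move=> /bmeas_integrable[fr fi] /bmeas_integrable[gr gi].
rewrite /cintegral -[RHS]/(_ +i* _); congr (_ +i* _).
- rewrite -RintegralD//; last exact: measurable_circle.
  by apply: eq_Rintegral => t _; case: (f t) (g t) => ? ? [].
- rewrite -RintegralD//; last exact: measurable_circle.
  by apply: eq_Rintegral => t _; case: (f t) (g t) => ? ? [].
Qed.

Lemma cintZ c f : bmeas f -> cint (fun t => c * f t) = c * cint f.
Proof.
move=> /bmeas_integrable[fr fi]; have mc := measurable_circle.
case: c => a b; rewrite /cintegral -[RHS]/(_ +i* _); congr (_ +i* _).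
- rewrite -!RintegralZl// -RintegralB//.
  + by apply: eq_Rintegral => t _; case: (f t).
  + exact: integrable_scale.
  + exact: integrable_scale.
- rewrite -!RintegralZl// -RintegralD//.
  + by apply: eq_Rintegral => t _; case: (f t).
  + exact: integrable_scale.
  + exact: integrable_scale.
Qed.

Lemma cintJ f : bmeas f -> cint (fun t => conjc (f t)) = conjc (cint f).
Proof.
move=> /bmeas_integrable[fr fi]; have mc := measurable_circle.
rewrite /cintegral -[RHS]/(_ +i* _); congr (_ +i* _).
- by apply: eq_Rintegral => t _; case: (f t).
- rewrite -mulN1r -RintegralZl//.
  by apply: eq_Rintegral => t _; case: (f t) => a b /=; rewrite mulN1r.
Qed.

Lemma cintN f : bmeas f -> cint (fun t => - f t) = - cint f.
Proof.
move=> mf; rewrite -mulN1r -cintZ//.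
by apply: cint_ext => t _; rewrite mulN1r.
Qed.

Lemma cintB f g : bmeas f -> bmeas g ->
  cint (fun t => f t - g t) = cint f - cint g.
Proof. by move=> mf mg; rewrite cintD ?cintN//; exact: bmeasN. Qed.

Lemma fine_mu1 : fine (mu circle) = 1.
Proof. by rewrite mu1. Qed.

Lemma cint_bound f M : bmeas f -> (forall t, circle t -> `|f t| <= M%:C) ->
  `|cint f| <= (M *+ 2)%:C.
Proof.
move=> mf fM; have [fr fi] := bmeas_integrable mf.
have mc := measurable_circle.
have bd (u : borelC R -> R) : mu.-integrable circle (EFin \o u) ->
    (forall t, circle t -> `|u t| <= M) -> `|\int[mu]_(t in circle) u t| <= M.
  move=> iu uM; apply: le_trans (le_normr_Rintegral mc iu) _.
  have e : \int[mu]_(t in circle) M = M.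
    rewrite Rintegral_cst//.
    by rewrite (_ : fine _ = 1) ?mulr1//; exact: fine_mu1.
  apply: (@le_trans _ _ (\int[mu]_(t in circle) M)); last first.
    by rewrite le_eqVlt; apply/orP; left; apply/eqP; exact: e.
  apply: le_Rintegral => //; last exact/finite_measure_integrable_cst.
  exact: integrable_norm.
have -> : cint f = (Re (cint f))%:C + 'i%C * (Im (cint f))%:C by exact: complexE.
rewrite mulr2n rmorphD (le_trans (ler_normD _ _))// lerD//.
  rewrite normc_def /= expr0n addr0 sqrtr_sqr lecR; apply: bd => // t ct.
  by rewrite -lecR; exact: le_trans (normc_ge_Re _) (fM _ ct).
rewrite normrM !normc_def /= !expr0n add0r addr0 expr1n sqrtr1 mul1r sqrtr_sqr.
rewrite lecR; apply: bd => // t ct.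
by rewrite -lecR; exact: le_trans (normc_ge_Im _) (fM _ ct).
Qed.

End fixed_measure.
End integral.

(** * Rational integrands and Cauchy integrals *)

Section circle_rational.
Context {R : realType}.
Notation C := R[i].
Implicit Types (x y : ratfun R) (z a b t : C) (p q : {poly C}).

Definition circle_regular x := forall t, circle t -> regular x t.

(** Numerator and denominator split into linear factors, so every rational
    function without poles on the circle is reached from the constants by sums,
    multiplication by 'X and division by 'X - a with a off the circle. This
    replaces partial fractions. *)
Lemma circle_regular_ind (P : ratfun R -> Prop) :
  (forall c, P (ratC c)) ->
  (forall x y, circle_regular x -> circle_regular y -> P x -> P y -> P (x + y)) ->
  (forall x, circle_regular x -> P x -> P (x * 'X%:F)) ->
  (forall x a, circle_regular x -> ~ circle a -> P x ->
    P (x / ('X - a%:P)%:F)) ->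
  forall x, circle_regular x -> P x.
Proof.
move=> Pc PD PX PV x rx.
have [p [q [q0 cpq e]]] := ratfun_coprime x.
have qt t : circle t -> q.[t] != 0.
  by move=> /rx; rewrite e; exact: regular_coprime.
have rp (u : {poly C}) : circle_regular u%:F by move=> t _; reg.
have Pp u : P u%:F.
  elim/poly_ind: u => [|u c ih]; first exact: Pc 0.
  rewrite tofracD; apply: PD; [exact: rp|exact: rp| |exact: Pc].
  by rewrite tofracM; exact: PX.
have [s es] := poly_split q.
have lq : lead_coef q != 0 by rewrite lead_coef_eq0.
have sc a : a \in s -> ~ circle a.
  move=> sa /qt; rewrite es hornerZ mulf_eq0 negb_or lq/=.
  by move=> /negP; apply; rewrite -[_ == 0]/(root _ _) root_prod_XsubC.
have {}e : x = ((lead_coef q)^-1%:P * p)%:F / (\prod_(a <- s) ('X - a%:P))%:F.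
  rewrite e {1}es; apply/eqP; rewrite GRing.eqr_div; last 2 first.
  - by rewrite tofrac_eq0 -es.
  - by rewrite tofrac_eq0; apply/monic_neq0/monic_prod_XsubC.
  rewrite -!tofracM tofrac_eq -mul_polyC; apply/eqP.
  rewrite [RHS](_ : _ = ((lead_coef q)^-1%:P * (lead_coef q)%:P)
    * (p * \prod_(a <- s) ('X - a%:P))); last by ring.
  by rewrite -polyCM mulVf// polyC1 mul1r.
move: e; set u := _ * p; rewrite {}/u; move: (_ * p) => u ->.
have : P (u%:F / (\prod_(a <- s) ('X - a%:P))%:F)
    /\ circle_regular (u%:F / (\prod_(a <- s) ('X - a%:P))%:F); last by case.
elim: s sc {es} => [|a s ih] sc.
  by rewrite big_nil tofrac1 divr1; split.
have [//|Pu ru] := ih _.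
  by move=> b sb; apply: sc; rewrite inE sb orbT.
have ca : ~ circle a by apply: sc; rewrite mem_head.
rewrite big_cons tofracM GRing.invfM mulrCA mulrC; split; first exact: PV.
move=> t ct; apply: regularM; first exact: ru.
apply: regularV; first by reg.
rewrite reval_poly hornerXsubC subr_eq0; apply/eqP => ta.
by apply: ca; rewrite -ta.
Qed.

Lemma disc_dist_circle z t : disc z -> circle t -> 1 - `|z| <= `|t - z|.
Proof. by move=> _ <-; exact: lerB_dist. Qed.

Lemma circle_neq z t : disc z -> circle t -> t - z != 0.
Proof.
move=> dz ct; rewrite -normr_gt0; apply: lt_le_trans (disc_dist_circle dz ct).
by rewrite subr_gt0.
Qed.

Lemma bmeas_invXsub a : ~ circle a -> bmeas (fun t => (t - a)^-1).
Proof.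
move=> ca; pose d := complex.Re `|1 - `|a| |.
have ed : d%:C = `|1 - `|a| | by rewrite /d RRe_real// normr_real.
have d0 : 0 < d.
  by rewrite -ltcR ed normr_gt0 subr_eq0 eq_sym; apply/eqP.
apply: (bmeasV d0); first by rewrite ed => t <-; exact: ler_dist_dist.
by apply: bmeasD; [exact: bmeas_id|exact: bmeas_cst].
Qed.

Lemma bmeas_reval x : circle_regular x -> bmeas (reval x).
Proof.
move: x; apply: circle_regular_ind.
- move=> c; apply: bmeas_ext (bmeas_cst c) => t _; rewrite reval_ratC//.
- move=> x y rx ry mx my; apply: bmeas_ext (bmeasD mx my) => t ct.
  by rewrite revalD; [|exact: rx|exact: ry].
- move=> x rx mx; apply: bmeas_ext (bmeasM mx bmeas_id) => t ct.
  by rewrite revalM; [rewrite reval_poly hornerX|exact: rx|reg].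
- move=> x a rx ca mx.
  apply: bmeas_ext (bmeasM mx (bmeas_invXsub ca)) => t ct.
  have ta : reval ('X - a%:P)%:F t != 0.
    rewrite reval_poly hornerXsubC subr_eq0; apply/eqP => ta.
    by apply: ca; rewrite -ta.
  rewrite revalM ?revalV//; [|by reg|exact: rx|apply: regularV => //; by reg].
  by rewrite reval_poly hornerXsubC.
Qed.

Lemma bmeas_poly p : bmeas (horner p).
Proof.
apply: bmeas_ext (bmeas_reval (_ : circle_regular p%:F)).
  by move=> t _; rewrite reval_poly.
by move=> t _; reg.
Qed.

End circle_rational.

(** bmeas for algebraic expressions in rational functions. *)
Ltac bms := repeat match goal with
  | H : bmeas ?f |- bmeas ?f => exact H
  | |- bmeas (fun w => @?f w + @?g w) => apply (@bmeasD _ f g)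
  | |- bmeas (fun w => - @?f w) => apply (@bmeasN _ f)
  | |- bmeas (fun w => @?f w * @?g w) => apply (@bmeasM _ f g)
  | |- bmeas (fun w => w) => exact (@bmeas_id _)
  | |- bmeas (fun w => ?c) => exact (@bmeas_cst _ c)
  | |- bmeas (fun w => (w - ?a)^-1) => apply (@bmeas_invXsub _ a)
  | |- bmeas (fun w => conjc (@?f w)) => apply (@bmeasJ _ f)
  | |- bmeas (fun w => reval ?x w) => apply (@bmeas_reval _ x)
  | |- bmeas (reval ?x) => apply (@bmeas_reval _ x)
  | |- bmeas (fun w => horner ?x w) => apply (@bmeas_poly _ x)
  | |- bmeas (fun w => ?f w) => change (bmeas f)
  end.

Section cauchy.
Context {R : realType}.
Notation C := R[i].
Implicit Types (x y : ratfun R) (z a b t : C) (p q : {poly C}) (w : C -> C).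
Variable mu : probability (borelC R) R.
Hypothesis mu1 : mu circle = 1%E.
Local Notation cint := (cintegral mu).

Definition cauchy w z := cint (fun t => w t / (t - z)).

Lemma disc_not_circle z : disc z -> ~ circle z.
Proof. by rewrite /disc/circle/= => h e; rewrite e ltxx in h. Qed.

(** The divided difference of a Cauchy integral is a Cauchy integral: the source
    of its continuity, and of the zeros that orthogonality creates. *)
Lemma cauchy_sub w a z : bmeas w -> disc a -> disc z ->
  cauchy w z - cauchy w a = (z - a) * cauchy (fun t => w t / (t - a)) z.
Proof.
move=> mw da dz.
have ca := disc_not_circle da; have cz := disc_not_circle dz.
rewrite /cauchy -cintB -?cintZ//; [|by bms..].
apply: cint_ext => t ct.
have := circle_neq da ct; have := circle_neq dz ct => tz ta.
by field; rewrite tz ta.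
Qed.

Lemma cont_cauchy w a : bmeas w -> disc a -> cont (cauchy w) a.
Proof.
move=> mw da; have ca := disc_not_circle da.
(* Half the distance from a to the circle: if |z - a| < d, then |t - z| >= d
   for all t on the circle. *)
pose d := complex.Re ((1 - `|a|) / 2).
have a1 : 0 < 1 - `|a| by rewrite subr_gt0.
have ed : d%:C = (1 - `|a|) / 2.
  by rewrite /d RRe_real// ger0_real// divr_ge0// ltW.
have d0 : 0 < d by rewrite -ltcR ed divr_gt0.
have [M hM] : exists M, forall t, circle t -> `|w t / (t - a)| <= M%:C.
  by have [_ _] : bmeas (fun t => w t / (t - a)) by bms.
pose K : C := (M / d *+ 2)%:C.
have bound z : `|z - a| < d%:C -> disc z ->
    `|cauchy (fun t => w t / (t - a)) z| <= K.
  move=> az dz; have cz := disc_not_circle dz.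
  apply: cint_bound => //; first by bms.
  move=> t ct; rewrite normrM rmorphM ler_pM ?hM//.
  have zd : d%:C <= `|t - z|.
    apply: le_trans (disc_dist_circle dz ct).
    have h : `|z| <= d%:C + `|a|.
      by rewrite -{1}(subrK a z) (le_trans (ler_normD _ _))// lerD2r ltW.
    rewrite lerBrDr; apply: le_trans (lerD (lexx _) h) _.
    by rewrite addrA ed -splitr subrK.
  have f0 : 0 < `|t - z| by apply: (lt_le_trans _ zd); rewrite ltcR.
  by rewrite normfV fmorphV lef_pV2// posrE// ltcR.
have K0 : 0 <= K.
  by apply: le_trans (bound a _ da); rewrite ?normr_ge0// subrr normr0 ltcR.
have near_dist (r : C) : 0 < r -> \forall z \near (a : C^o), `|z - a| < r.
  move=> r0; apply/(@nbhs_ballP _ C^o); exists r => // z.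
  by rewrite /ball/= distrC.
move=> U /(@nbhs_ballP _ C^o)[e /= e0 eU].
have ff : Filter (nbhs (a : C^o)) by exact: nbhs_filter.
have n1 : \forall z \near (a : C^o), `|z - a| < d%:C.
  by apply: near_dist; rewrite ltcR.
have n2 : \forall z \near (a : C^o), `|z - a| < e / (K + 1).
  by apply: near_dist; rewrite divr_gt0// ltr_wpDl.
apply: (@filterS3 _ (nbhs (a : C^o)) ff _ _ _ _ _ n1 n2 (disc_near da)).
move=> z az az' dz; apply: eU; rewrite /ball/=.
rewrite distrC cauchy_sub// normrM.
apply: le_lt_trans (ler_wpM2l (normr_ge0 _) (bound z az dz)) _.
move: az'; rewrite ltr_pdivlMr ?ltr_wpDl//; apply: le_lt_trans.
by rewrite mulrDr mulr1 lerDl.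
Qed.
End cauchy.

(** * The Riesz-Herglotz kernel *)

Section kernel.
Context {R : realType}.
Notation C := R[i].
Implicit Types (x y : ratfun R) (z w a b t : C) (p q : {poly C}).

(** The morphism laws of conjc, stated for conjc itself so that they rewrite. *)
Lemma conjcD z w : conjc (z + w) = conjc z + conjc w. Proof. exact: rmorphD. Qed.
Lemma conjcN z : conjc (- z) = - conjc z. Proof. exact: rmorphN. Qed.
Lemma conjcM z w : conjc (z * w) = conjc z * conjc w. Proof. exact: rmorphM. Qed.
Lemma conjcV z : conjc z^-1 = (conjc z)^-1. Proof. exact: fmorphV. Qed.
Lemma conjc_one : conjc 1 = 1 :> C. Proof. exact: rmorph1. Qed.
Lemma conjc_conjc z : conjc (conjc z) = z. Proof. exact: conjcK. Qed.
Definition conjcE := (conjcD, conjcN, conjcM, conjcV, conjc_one, conjc_conjc).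

Lemma horner_varpi b z : (varpi b).[z] = 1 - conjc b * z.
Proof. by rewrite /varpi !hornerE. Qed.

Lemma horner_varpis b z : (varpis b).[z] = z - b.
Proof. by rewrite /varpis !hornerE. Qed.

Lemma varpi_neq0 b z : disc b -> `|z| <= 1 -> (varpi b).[z] != 0.
Proof.
move=> db z1; rewrite horner_varpi subr_eq0; apply/eqP => /(congr1 Num.norm).
rewrite normr1 normrM normcJ => e.
have : `|b| * `|z| < 1.
  apply: le_lt_trans (db : `|b| < 1).
  by rewrite -[leRHS]mulr1 ler_wpM2l.
by rewrite -e ltxx.
Qed.

Lemma disc_le1 z : disc z -> `|z| <= 1. Proof. exact: ltW. Qed.
Lemma circle_le1 z : circle z -> `|z| <= 1. Proof. by move=> ->. Qed.

Lemma conjc_circle t : circle t -> conjc t = t^-1.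
Proof.
move=> ct; have t0 : t != 0 by rewrite -normr_eq0 ct oner_neq0.
apply: (mulfI t0); rewrite divff//.
by rewrite -sqr_normc ct expr1n.
Qed.

Lemma eta_norm b : Defs.eta b * conjc (Defs.eta b) = 1.
Proof.
rewrite /Defs.eta; case: ifPn => [_|b0].
  by rewrite rmorph1 mulr1.
have n0 : `|b| != 0 by rewrite normr_eq0.
have -> : conjc (conjc b / `|b|) = b / `|b|.
  rewrite (rmorphM (@conjc R)) (fmorphV (@conjc R)).
  congr (_ / _); first exact: conjcK.
  by rewrite normc_def; exact: conjc_real.
rewrite mulrACA [conjc b * b]mulrC -sqr_normc.
by rewrite -GRing.invfM -expr2 mulfV// expf_neq0.
Qed.

Lemma eta_neq0 b : Defs.eta b != 0.
Proof.
by apply: contra_eqN (eta_norm b) => /eqP ->; rewrite mul0r eq_sym oner_neq0.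
Qed.

Lemma reval_zeta b z : (varpi b).[z] != 0 ->
  regular (zeta b) z /\ reval (zeta b) z = Defs.eta b * (z - b) / (1 - conjc b * z).
Proof.
move=> vz; have e : zeta b = ((Defs.eta b)%:P * varpis b)%:F / (varpi b)%:F.
  by rewrite /zeta /ratC tofracM.
rewrite e; split; first by exists ((Defs.eta b)%:P * varpis b), (varpi b).
by rewrite reval_frac// hornerM hornerC horner_varpis horner_varpi.
Qed.

(** This is 1 / (1 - |b|^2), written without the norm to keep it algebraic. *)
Definition kernel_weight b : C := (1 - b * conjc b)^-1.

Lemma kernel_weight_neq0 b : disc b -> 1 - b * conjc b != 0.
Proof.
by move=> db; have := varpi_neq0 db (disc_le1 db); rewrite horner_varpi mulrC.
Qed.

(** In terms of t and z the kernel has its only singularity at t = z: the poles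
    of zeta cancel in the quotient. *)
Lemma kernelE b t z : disc b -> (varpi b).[z] != 0 -> circle t ->
  kernelD b t z = kernel_weight b * ((t - b) * (1 - conjc b * z) +
                           (z - b) * (1 - conjc b * t)) / (t - z).
Proof.
move=> db vz ct.
have vt := varpi_neq0 db (circle_le1 ct).
have [_ ez] := reval_zeta vz; have [_ et] := reval_zeta vt.
rewrite /kernelD ez et /kernel_weight; have k0 := kernel_weight_neq0 db.
move: vz vt; rewrite !horner_varpi => vz vt; have e0 := eta_neq0 b.
have [->|tz] := eqVneq t z; first by rewrite !subrr !invr0 !mulr0.
have tz' : t - z != 0 by rewrite subr_eq0.
move: (conjc b) (Defs.eta b) vz vt k0 e0 => c e vz vt k0 e0.
have -> : e * (t - b) / (1 - c * t) - e * (z - b) / (1 - c * z) =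
  e * (1 - b * c) * (t - z) / ((1 - c * t) * (1 - c * z)).
  by field; rewrite vz vt.
by field; rewrite k0 tz' vz vt e0.
Qed.

(** Up to the constant 1 the kernel is a Cauchy kernel: D + 1 vanishes at t = b,
    and D - 1 at z = b, whence the factor zeta_0 in the factorizations. *)
Lemma kernel_plus b t z : disc b -> disc z -> circle t ->
  kernelD b t z = kernel_weight b *+ 2 * (1 - conjc b * z) * ((t - b) / (t - z)) - 1.
Proof.
move=> db dz ct; rewrite kernelE ?varpi_neq0 ?disc_le1//.
have := kernel_weight_neq0 db; have := circle_neq dz ct.
rewrite /kernel_weight => tz k0.
by field; rewrite k0 tz.
Qed.

Lemma kernel_minus b t z : disc b -> disc z -> circle t ->
  kernelD b t z =
  kernel_weight b *+ 2 * (z - b) * ((1 - conjc b * t) / (t - z)) + 1.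
Proof.
move=> db dz ct; rewrite kernelE ?varpi_neq0 ?disc_le1//.
have := kernel_weight_neq0 db; have := circle_neq dz ct.
rewrite /kernel_weight => tz k0.
by field; rewrite k0 tz.
Qed.

Lemma conj_kernel_weight b : conjc (kernel_weight b) = kernel_weight b.
Proof. by rewrite /kernel_weight !conjcE mulrC. Qed.

(** Reflection in the circle changes the sign of the kernel; hence the minus sign
    in phi^* F - psi^*. *)
Lemma kernel_conj b t z : disc b -> disc z -> z != 0 -> circle t ->
  (varpi b).[(conjc z)^-1] != 0 ->
  conjc (kernelD b t (conjc z)^-1) = - kernelD b t z.
Proof.
move=> db dz z0 ct vw.
rewrite (kernelE db vw ct) (kernelE db _ ct) ?varpi_neq0 ?disc_le1//.
have := conj_kernel_weight b; move: (kernel_weight b) => k hk.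
rewrite !conjcE hk conjc_circle//.
have tz := circle_neq dz ct.
have t0 : t != 0 by rewrite -normr_eq0 ct oner_neq0.
have zt : t^-1 - z^-1 != 0.
  by rewrite subr_eq0 (inj_eq invr_inj) -subr_eq0.
move: (conjc b) => c.
have -> : t^-1 - z^-1 = - (t - z) / (t * z) by field; rewrite t0 z0.
by field; rewrite t0 z0 tz.
Qed.

End kernel.

(** * Rationality of the functions of the second kind *)

Section second_kind_functions.
Context {R : realType}.
Notation C := R[i].
Implicit Types (x y : ratfun R) (z w a b t : C) (p q : {poly C}).
Variable mu : probability (borelC R) R.
Hypothesis mu1 : mu circle = 1%E.
Local Notation cint := (cintegral mu).
Local Notation cauchy := (cauchy mu).
Variable b : C.
Hypothesis db : disc b.

(** These densities come from D + 1 and D - 1: see kernel_plus and kernel_minus. *)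
Definition wplus x t := (t - b) * reval x t.
Definition wminus x t := (1 - conjc b * t) * reval x t.

Lemma bmeas_wplus x : circle_regular x -> bmeas (wplus x).
Proof. by move=> rx; rewrite /wplus; bms. Qed.
Lemma bmeas_wminus x : circle_regular x -> bmeas (wminus x).
Proof. by move=> rx; rewrite /wminus; bms. Qed.

Lemma almost_varpi : almost (fun z => (varpi b).[z] != 0).
Proof.
apply: almost_poly; apply: (@horner_neq0 _ _ 0).
by rewrite horner_varpi mulr0 subr0 oner_neq0.
Qed.

Lemma bmeas_kernel z : (varpi b).[z] != 0 -> ~ circle z ->
  bmeas (fun t => kernelD b t z).
Proof.
move=> vz cz; apply: (@bmeas_ext _ (fun t =>
  kernel_weight b * ((t - b) * (1 - conjc b * z) + (z - b) * (1 - conjc b * t))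
  * (t - z)^-1)); last by bms.
by move=> t ct; rewrite kernelE.
Qed.

(** The integral of D(t,z) (x(t) - x(z)) is a rational function of z: by
    linearity it is enough to follow it when x is multiplied by 'X or by
    1 / ('X - a), which cancels the singularity of the kernel at t = z. *)
Lemma second_kind_exists x : circle_regular x ->
  exists y, circle_regular y /\ almost (fun z => ~ circle z ->
    reval y z = cint (fun t => kernelD b t z * (reval x t - reval x z))).
Proof.
move: x; apply: circle_regular_ind.
- move=> c; exists (ratC 0); split; first by move=> t _; reg.
  exists [::] => z _ _; rewrite reval_ratC.
  rewrite (@cint_ext _ _ _ (fun=> 0 * 0)).
    by rewrite (cintZ mu1) ?mul0r//; exact: bmeas_cst.
  by move=> t _; rewrite !reval_ratC subrr !mulr0.
- move=> x x' rx rx' [y [ry hy]] [y' [ry' hy']]; exists (y + y').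
  split; first by move=> t ct; apply: regularD; [exact: ry|exact: ry'].
  have := almost_and hy hy'.
  move=> /(almost_and (almost_regular y))/(almost_and (almost_regular y')).
  move=> /(almost_and (almost_regular x))/(almost_and (almost_regular x')).
  move=> /(almost_and almost_varpi).
  apply: almost_mono => z [vz [rxz' [rxz [ryz' [ryz [{}hy {}hy']]]]]] cz.
  have mk := bmeas_kernel vz cz.
  rewrite revalD// hy// hy'// -cintD//; [|by bms..].
  apply: cint_ext => t ct; rewrite (revalD rxz)// revalD; first ring.
    exact: rx.
  exact: rx'.
- move=> x rx [y [ry hy]].
  pose m1 := cint (wplus x); pose m2 := cint (wminus x).
  exists (y * 'X%:F
    + ((kernel_weight b * m1) *: varpi b + (kernel_weight b * m2) *: varpis b)%:F).
  split.
    by move=> t ct; apply: regularD; [apply: regularM; [exact: ry|]|]; reg.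
  move: hy.
  move=> /(almost_and (almost_regular y))/(almost_and (almost_regular x)).
  move=> /(almost_and almost_varpi).
  apply: almost_mono => z [vz [rxz [ryz hy]]] cz.
  have mk := bmeas_kernel vz cz.
  rewrite revalD; [|by reg..]; rewrite revalM; [|by reg..].
  rewrite !reval_poly hornerX hornerD !hornerZ horner_varpi horner_varpis hy//.
  rewrite mulrC -cintZ//; last by bms.
  rewrite mulrAC [X in _ + (_ + X)]mulrAC.
  rewrite -!cintZ//; [|exact: bmeas_wminus|exact: bmeas_wplus].
  have mp := bmeas_wplus rx; have mm := bmeas_wminus rx.
  rewrite -cintD//; [|by bms..]. rewrite -cintD//; [|by bms..].
  apply: cint_ext => t ct.
  rewrite revalM; [|exact: rx|by reg]; rewrite (revalM rxz); last by reg.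
  rewrite !reval_poly !hornerX kernelE// /wplus /wminus.
  have tz : t - z != 0 by rewrite subr_eq0; apply: contra_notN cz => /eqP <-.
  by field.
- move=> x a rx ca [y [ry hy]].
  pose i := (('X - a%:P)%:F)^-1 : ratfun R.
  have ri z : z != a -> regular i z /\ reval i z = (z - a)^-1.
    move=> za; have ni : reval ('X - a%:P)%:F z != 0.
      by rewrite reval_poly hornerXsubC subr_eq0.
    split; first by apply: regularV => //; reg.
    by rewrite revalV//; [rewrite reval_poly hornerXsubC|reg].
  have ci t : circle t -> t != a by move=> ct; apply/eqP => ta; apply: ca; rewrite -ta.
  pose m1 := cint (fun t => wplus x t / (t - a)).
  pose m2 := cint (fun t => wminus x t / (t - a)).
  exists ((y - ((kernel_weight b * m1) *: varpi b
    + (kernel_weight b * m2) *: varpis b)%:F) * i).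
  split.
    move=> t ct; apply: regularM; last by case: (ri t (ci t ct)).
    by apply: regularD; [exact: ry|reg].
  move: hy.
  move=> /(almost_and (almost_regular y))/(almost_and (almost_regular x)).
  move=> /(almost_and almost_varpi)/(almost_and (almost_neq a)).
  apply: almost_mono => z [za [vz [rxz [ryz hy]]]] cz.
  have mk := bmeas_kernel vz cz.
  have [riz eiz] := ri z za.
  rewrite revalM//; last by reg.
  rewrite revalD//; [|by reg..]; rewrite revalN; last by reg.
  rewrite reval_poly hornerD !hornerZ horner_varpi horner_varpis hy// eiz.
  have mp := bmeas_wplus rx; have mm := bmeas_wminus rx.
  rewrite mulrAC [X in _ - (_ + X)]mulrAC.
  rewrite -!cintZ//; [|by bms..].
  rewrite -cintD//; [|by bms..]. rewrite -cintB//; [|by bms..].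
  rewrite mulrC -cintZ//; [|by bms..].
  apply: cint_ext => t ct.
  have [rit eit] := ri t (ci t ct).
  rewrite revalM//; [|exact: rx]; rewrite (revalM rxz)// eit eiz.
  rewrite kernelE// /wplus /wminus.
  have tz : t - z != 0 by rewrite subr_eq0; apply: contra_notN cz => /eqP <-.
  have := ci t ct; rewrite -subr_eq0 => ta; move: za; rewrite -subr_eq0 => za.
  by field; rewrite tz ta za.
Qed.

End second_kind_functions.

(** * Functions of the second kind and their substar conjugates *)

Section substar_circle.
Context {R : realType}.
Notation C := R[i].
Implicit Types (x y : ratfun R) (z w a b t : C).

Lemma circle_inv t : circle t -> t != 0 /\ (conjc t)^-1 = t.
Proof.
move=> ct; rewrite conjc_circle// invrK; split => //.
by rewrite -normr_eq0 ct oner_neq0.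
Qed.

Lemma reval_substar_circle x t : regular x t -> circle t ->
  regular (substar x) t /\ reval (substar x) t = conjc (reval x t).
Proof.
move=> rx /circle_inv[t0 tt]; have := @reval_substar _ x t t0.
by rewrite tt => /(_ rx).
Qed.

Lemma circle_regular_substar x : circle_regular x -> circle_regular (substar x).
Proof. by move=> rx t ct; have [] := reval_substar_circle (rx t ct) ct. Qed.

Lemma disc0 : disc (0 : C).
Proof. by rewrite /disc/= normr0 ltr01. Qed.

Lemma around_disc z : disc z -> around z (fun w : C => disc w).
Proof. by move=> dz; exact: around_nbhs (disc_near dz). Qed.

Lemma disc_reflect z : disc z -> z != 0 -> ~ circle (conjc z)^-1.
Proof.
rewrite /disc/circle/= normfV normcJ => dz z0 e.
by move: dz; rewrite -[`|z|]invrK e invr1 ltxx.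
Qed.

End substar_circle.

Section second_kind_pairs.
Context {R : realType}.
Notation C := R[i].
Implicit Types (x y : ratfun R) (z w a t : C) (p q : {poly C}).
Variable mu : probability (borelC R) R.
Variables (b : C) (F : C -> C).
Hypotheses (db : disc b) (hF : herglotz b F mu).
Local Notation cint := (cintegral mu).
Local Notation cauchy := (cauchy mu).

Let mu1 : mu circle = 1%E. Proof. by case: hF. Qed.

(** The value of F is the integral of the kernel, so the subtracted term x(z) in
    the definition of the second kind contributes - x(z) F(z). *)
Lemma cint_kernel_sub x z : circle_regular x -> disc z ->
  cint (fun t => kernelD b t z * (reval x t - reval x z)) =
  cint (fun t => kernelD b t z * reval x t) - reval x z * F z.
Proof.
move=> rx dz.
have mk : bmeas (fun t => kernelD b t z).
  by apply: bmeas_kernel; [|exact: varpi_neq0 (disc_le1 dz)|exact: disc_not_circle].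
case: hF => _ ->//; rewrite -(cintZ mu1)// -(cintB mu1); [|by bms..].
by apply: cint_ext => t _; ring.
Qed.

Lemma cint_kernel_plus x z : circle_regular x -> disc z ->
  cint (fun t => kernelD b t z * reval x t) =
  kernel_weight b *+ 2 * (1 - conjc b * z) * cauchy (wplus b x) z - Defs.Lfun mu x.
Proof.
move=> rx dz; have mp := bmeas_wplus b rx.
have cz := disc_not_circle dz.
rewrite /cauchy -(cintZ mu1)//; [|by bms..].
rewrite -(cintB mu1)//; [|by bms..].
apply: cint_ext => t ct; rewrite kernel_plus// /wplus; ring.
Qed.

Lemma cint_kernel_minus x z : circle_regular x -> disc z ->
  cint (fun t => kernelD b t z * reval x t) =
  kernel_weight b *+ 2 * (z - b) * cauchy (wminus b x) z + Defs.Lfun mu x.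
Proof.
move=> rx dz; have mp := bmeas_wminus b rx.
have cz := disc_not_circle dz.
rewrite /cauchy -(cintZ mu1)//; [|by bms..].
rewrite -(cintD mu1)//; [|by bms..].
apply: cint_ext => t ct; rewrite kernel_minus// /wminus; ring.
Qed.

Lemma second_kind_formula x z : circle_regular x -> disc z ->
  cint (fun t => kernelD b t z * (reval x t - reval x z)) + Defs.Lfun mu x =
  kernel_weight b *+ 2 * (1 - conjc b * z) * cauchy (wplus b x) z - reval x z * F z.
Proof.
by move=> rx dz; rewrite cint_kernel_sub// cint_kernel_plus//; ring.
Qed.

Lemma Lfun_substar x : circle_regular x ->
  Defs.Lfun mu (substar x) = conjc (Defs.Lfun mu x).
Proof.
move=> rx; rewrite /Defs.Lfun -(cintJ mu1); last by bms.
by apply: cint_ext => t ct; have [] := reval_substar_circle (rx t ct) ct.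
Qed.

(** The function of the second kind y of x, and its substar conjugate: the
    conjugate formula at 1 / conj z turns the kernel into its opposite. *)
Lemma second_kind_pair x : circle_regular x ->
  exists y, [/\ circle_regular y,
    almost (fun z => disc z -> reval y z =
      kernel_weight b *+ 2 * (1 - conjc b * z) * cauchy (wplus b x) z
      - reval x z * F z) &
    almost (fun z => disc z -> reval (substar y) z =
      reval (substar x) z * F z -
      kernel_weight b *+ 2 * (z - b) * cauchy (wminus b (substar x)) z)].
Proof.
move=> rx; have [y [ry hy]] := second_kind_exists mu1 db rx.
exists (y + ratC (Defs.Lfun mu x)); split.
- by move=> t ct; apply: regularD; [exact: ry|reg].
- apply: almost_mono (almost_and hy (almost_regular y)) => z [{}hy ryz] dz.
  rewrite revalD//; last by reg.
  rewrite reval_ratC hy; last exact: disc_not_circle.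
  exact: second_kind_formula.
have rxs := circle_regular_substar rx.
move: hy => /(almost_and (almost_varpi b))/(almost_and (almost_regular x)).
move=> /(almost_and (almost_regular y))/almost_reflect.
move=> /(almost_and (almost_neq 0)).
apply: almost_mono => z [z0 [ryw [rxw [vw hy]]]] dz.
have cw := disc_reflect dz z0.
have ryw' : regular (y + ratC (Defs.Lfun mu x)) (conjc z)^-1 by reg.
have [_ ->] := reval_substar z0 ryw'.
rewrite revalD//; last by reg.
rewrite reval_ratC hy// conjcD -Lfun_substar//.
have mk := bmeas_kernel db vw cw.
rewrite -(cintJ mu1); last by bms.
have [_ ex] := reval_substar z0 rxw.
have -> : cint (fun t => conjc (kernelD b t (conjc z)^-1 *
      (reval x t - reval x (conjc z)^-1))) =
    - cint (fun t => kernelD b t z * (reval (substar x) t - reval (substar x) z)).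
  rewrite -(cintN mu1).
    apply: cint_ext => t ct; rewrite conjcM kernel_conj// conjcD conjcN.
    have [_ ->] := reval_substar_circle (rx t ct) ct.
    by rewrite ex mulNr.
  have mk' : bmeas (fun t => kernelD b t z).
    by apply: bmeas_kernel; [|exact: varpi_neq0 (disc_le1 dz)|exact: disc_not_circle].
  by bms.
by rewrite cint_kernel_sub// cint_kernel_minus//; ring.
Qed.

Hypothesis cF : forall z, disc z -> cont F z.

(** The values in the disc determine a rational function; this identifies psi with
    the rational function of second_kind_pair, whose conjugate is known. *)
Lemma second_kind_unique x y psi :
  second_kind mu b x psi -> circle_regular x ->
  almost (fun z => disc z -> reval y z =
    kernel_weight b *+ 2 * (1 - conjc b * z) * cauchy (wplus b x) z
    - reval x z * F z) ->
  psi = y.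
Proof.
move=> hpsi rx hy; apply: (@ratfun_ext _ _ _ 0).
apply: around_mono (around_and (around_disc disc0) (around_almost 0 hy)).
by move=> z [dz ->//]; rewrite hpsi// second_kind_formula.
Qed.

Lemma regular_second_kind x y : circle_regular x ->
  (forall z, disc z -> regular x z) ->
  almost (fun z => disc z -> reval y z =
    kernel_weight b *+ 2 * (1 - conjc b * z) * cauchy (wplus b x) z
    - reval x z * F z) ->
  forall z, disc z -> regular y z /\ reval y z =
    kernel_weight b *+ 2 * (1 - conjc b * z) * cauchy (wplus b x) z - reval x z * F z.
Proof.
move=> cx rx hy z dz; apply: (regular_around (u := fun z =>
    kernel_weight b *+ 2 * (1 - conjc b * z) * cauchy (wplus b x) z - reval x z * F z)).
  have := cont_cauchy mu1 (bmeas_wplus b cx) dz.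
  have := cont_reval (rx z dz); have := cF dz => *; by conts.
apply: around_mono (around_and (around_disc dz) (around_almost z hy)).
by move=> w [dw ->].
Qed.

End second_kind_pairs.

(** * Substar conjugates of the spaces L_k *)

Section substar_spaces.
Context {R : realType}.
Notation C := R[i].
Implicit Types (x y : ratfun R) (z w a t : C) (p q : {poly C}).

(** z^k times the conjugate of p(1 / conj z). *)
Definition conj_reverse k p : {poly C} := \poly_(i < k.+1) conjc p`_(k - i).

Lemma X_neq0 : 'X%:F != 0 :> ratfun R.
Proof. by rewrite tofrac_eq0 polyX_eq0. Qed.

Lemma substarX : substar 'X%:F = ('X%:F)^-1 :> ratfun R.
Proof. by rewrite substar_poly poly_substarE !map_polyX hornerX. Qed.

Lemma poly_substar_reverse k p : (size p <= k.+1)%N ->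
  poly_substar p = (conj_reverse k p)%:F / 'X%:F ^+ k.
Proof.
move=> sp; rewrite /poly_substar.
rewrite (big_ord_widen k.+1 (fun i => ratC (conjc p`_i) * 'X%:F^-1 ^+ i) sp).
rewrite big_mkcond /=.
rewrite /conj_reverse poly_def rmorph_sum mulr_suml [RHS](reindex_inj rev_ord_inj).
apply: eq_bigr => i _ /=.
have ik : (i <= k)%N by rewrite -ltnS.
rewrite subSS subKn// -mul_polyC tofracM tofracXn.
rewrite -mulrA.
have -> : 'X%:F ^+ (k - i) / 'X%:F ^+ k = 'X%:F^-1 ^+ i :> ratfun R.
  have X0 n : 'X%:F ^+ n != 0 :> ratfun R by rewrite expf_neq0// X_neq0.
  apply/eqP; rewrite exprVn -[eqbRHS]mul1r GRing.eqr_div//.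
  by rewrite -exprD subnK// mul1r.
by case: ltnP => // /(nth_default 0) ->; rewrite (rmorph0 (@conjc R)) rmorph0 mul0r.
Qed.

Lemma conj_reverseK k p : (size p <= k.+1)%N ->
  conj_reverse k (conj_reverse k p) = p.
Proof.
move=> sp; apply/polyP => i; rewrite !coef_poly.
case: ltnP => ik; last by rewrite nth_default// (leq_trans sp).
by rewrite ltnS leq_subr conjc_conjc subKn.
Qed.

Lemma size_conj_reverse k p : (size (conj_reverse k p) <= k.+1)%N.
Proof. exact: size_poly. Qed.

Lemma substar_varpi b : substar (varpi b)%:F = (varpis b)%:F / 'X%:F :> ratfun R.
Proof.
rewrite /varpi /varpis -mul_polyC tofracB tofracM tofrac1 -[X in 1 - X * _]/(ratC _).
rewrite substarD substarN substarM substar1 substar_ratC substarX conjc_conjc.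
by rewrite tofracB mulrBl divff// X_neq0.
Qed.

Lemma substar_prod_varpi (b : nat -> C) k :
  substar (\prod_(1 <= j < k.+1) varpi (b j))%:F =
  (\prod_(1 <= j < k.+1) varpis (b j))%:F / 'X%:F ^+ k.
Proof.
elim: k => [|k ih]; first by rewrite !big_geq// tofrac1 expr0 divr1 substar1.
rewrite big_nat_recr//= [in RHS]big_nat_recr//= !tofracM substarM ih.
by rewrite substar_varpi exprSr mulf_div.
Qed.

Lemma varpi_poly_neq0 b : varpi b != 0 :> {poly C}.
Proof.
by apply: (@horner_neq0 _ _ 0); rewrite horner_varpi mulr0 subr0 oner_neq0.
Qed.

(** The conjugates of the elements of L_k are exactly the q / prod (z - b_j) with
    q of degree at most k, since conj_reverse k is an involution. *)
Lemma substar_Lsp_frac (b : nat -> C) k p : (size p <= k.+1)%N ->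
  substar (p%:F / (\prod_(1 <= j < k.+1) varpi (b j))%:F) =
  (conj_reverse k p)%:F / (\prod_(1 <= j < k.+1) varpis (b j))%:F.
Proof.
move=> sp; rewrite substarM substarV substar_prod_varpi substar_poly.
rewrite (poly_substar_reverse sp) GRing.invfM invrK mulrACA.
by rewrite [in X in _ * X]mulrC divff ?mulr1// expf_neq0// X_neq0.
Qed.

End substar_spaces.

(** * Orthogonality and zeros of Cauchy integrals *)

Section orthogonality.
Context {R : realType}.
Notation C := R[i].
Implicit Types (x y : ratfun R) (z w a t : C) (p q : {poly C}).
Variable mu : probability (borelC R) R.
Hypothesis mu1 : mu circle = 1%E.
Local Notation cint := (cintegral mu).
Local Notation cauchy := (cauchy mu).
Variable b : nat -> C.

(** The densities of Newton's divided differences at b_0, b_1, ... of the Cauchy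
    integral that comes from the kernel D + 1. The factor t - b_0 of D + 1 cancels
    the first node, so that newton x j.+1 integrates to the moment of x against
    1 / ((t - b_1) ... (t - b_j)). *)
Definition newton x j t :=
  reval x t * (t - b 0%N) * (\prod_(0 <= i < j) (t - b i))^-1.

Lemma bmeas_prodV m j : (forall i, (m <= i < j)%N -> disc (b i)) ->
  bmeas (fun t => (\prod_(m <= i < j) (t - b i))^-1).
Proof.
elim: j => [|j ih] db.
  by apply: bmeas_ext (bmeas_cst 1) => t _; rewrite big_geq// invr1.
have [jm|mj] := leqP m j; last first.
  by apply: bmeas_ext (bmeas_cst 1) => t _; rewrite big_geq// invr1.
apply: (@bmeas_ext _ (fun t => (\prod_(m <= i < j) (t - b i))^-1 * (t - b j)^-1)).
  by move=> t ct; rewrite big_nat_recr//= GRing.invfM.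
have mp : bmeas (fun t => (\prod_(m <= i < j) (t - b i))^-1).
  apply: ih => i /andP[mi ij].
  by apply: db; rewrite mi ltnW.
bms; apply: disc_not_circle; apply: db; rewrite jm ltnSn//.
Qed.

Lemma bmeas_newton x j : circle_regular x -> (forall i, (i < j)%N -> disc (b i)) ->
  bmeas (newton x j).
Proof.
move=> rx db; rewrite /newton.
have mp := @bmeas_prodV 0 j db.
by bms.
Qed.

Lemma newtonS x j t : newton x j.+1 t = newton x j t / (t - b j).
Proof. by rewrite /newton big_nat_recr//= GRing.invfM mulrA. Qed.

Lemma cauchy_newtonS x j z : circle_regular x ->
  (forall i, (i <= j)%N -> disc (b i)) -> disc z ->
  cauchy (newton x j) z =
    cint (newton x j.+1) + (z - b j) * cauchy (newton x j.+1) z.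
Proof.
move=> rx db dz.
have mw : bmeas (newton x j).
  by apply: bmeas_newton => // i ij; apply: db; exact: ltnW.
have -> : newton x j.+1 = fun t => newton x j t / (t - b j).
  by apply/funext => t; rewrite newtonS.
by rewrite -cauchy_sub//; [rewrite addrC subrK|exact: db].
Qed.

(** Orthogonality produces zeros: by Newton's divided differences the vanishing
    moments are the successive values of the Cauchy integral at the points b. *)
Lemma cauchy_newton_zeros x m z : circle_regular x ->
  (forall i, (i < m)%N -> disc (b i)) ->
  (forall j, (j < m)%N -> cint (newton x j.+1) = 0) -> disc z ->
  cauchy (newton x 0) z =
    (\prod_(0 <= i < m) (z - b i)) * cauchy (newton x m) z.
Proof.
move=> rx + + dz; elim: m => [|m ih] db hm.
  by rewrite big_geq// mul1r.
rewrite ih; [|by move=> i im; apply: db; exact: ltnW..|]; last first.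
  by move=> i im; apply: hm; exact: ltnW.
by rewrite cauchy_newtonS// hm// add0r mulrA big_nat_recr.
Qed.

(** Conversely zeros give vanishing moments. The cofactor K is only assumed near
    the nodes, because the quotient that plays its role later has a denominator
    which is controlled only there. *)
Lemma zeros_cauchy_newton x m (K : C -> C) : circle_regular x ->
  (forall i, (i < m)%N -> disc (b i)) ->
  (forall i, (i < m)%N -> cont K (b i)) ->
  (forall l, (l < m)%N -> around (b l) (fun z =>
    cauchy (newton x 0) z = (\prod_(0 <= i < m) (z - b i)) * K z)) ->
  forall j, (j < m)%N -> cint (newton x j.+1) = 0.
Proof.
move=> rx db cK h0.
have ccn j l : (j <= m)%N -> (l < m)%N -> cont (cauchy (newton x j)) (b l).
  move=> jm lm; apply: cont_cauchy => //; last exact: db.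
  by apply: bmeas_newton => // i ij; apply: db; exact: leq_trans jm.
have cprod j a : cont (fun z => \prod_(j <= i < m) (z - b i)) a.
  by apply: cont_prod => i; conts.
have step j : (j < m)%N -> (forall l, (j <= l < m)%N -> around (b l) (fun z =>
    cauchy (newton x j) z = (\prod_(j <= i < m) (z - b i)) * K z)) ->
    cint (newton x j.+1) = 0.
  move=> jm hj.
  have e : cauchy (newton x j) (b j) = (\prod_(j <= i < m) (b j - b i)) * K (b j).
    apply: (cont_eq (ccn j j (ltnW jm) jm)
      (_ : cont (fun z => (\prod_(j <= i < m) (z - b i)) * K z) _)).
      have := cK j jm; have := cprod j (b j) => *; by conts.
    by apply: hj; rewrite leqnn.
  move: e; rewrite cauchy_newtonS//; last 2 first.
  - by move=> i ij; apply: db; exact: leq_ltn_trans jm.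
  - exact: db.
  by rewrite (big_ltn jm) subrr !mul0r addr0.
(* Once the j-th moment vanishes, the factor z - b_j can be divided out; at nodes
   that coincide with b_j this is done in a punctured neighbourhood. *)
suff hj j : (j <= m)%N -> forall l, (j <= l < m)%N -> around (b l) (fun z =>
    cauchy (newton x j) z = (\prod_(j <= i < m) (z - b i)) * K z).
  by move=> j jm; exact: step jm (hj j (ltnW jm)).
elim: j => [|j ih] jm l /andP[jl lm]; first exact: h0.
have hj := ih (ltnW jm).
have mom := step j jm hj.
have dl := db l lm.
apply: around_mono (around_and (around_and (around_disc dl)
   (hj l _)) (around_almost (b l) (almost_neq (b j)))); last first.
  by rewrite (ltnW jl).
move=> z [[dz e] zj].
have zj' : z - b j != 0 by rewrite subr_eq0.
apply: (mulfI zj'); move: e; rewrite cauchy_newtonS//; last first.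
  by move=> i ij; apply: db; exact: leq_ltn_trans jm.
by rewrite mom add0r (big_ltn jm) mulrA.
Qed.

Lemma newton1E x j t : circle t -> disc (b 0%N) ->
  newton x j.+1 t = reval x t * (\prod_(1 <= i < j.+1) (t - b i))^-1.
Proof.
move=> ct d0; have t0 := circle_neq d0 ct.
rewrite /newton big_ltn// GRing.invfM mulrA; congr (_ * _).
by rewrite -mulrA divff// mulr1.
Qed.

(** Successive division of q by 'X - b_m, 'X - b_(m-1), ... writes
    q / prod (t - b_i) as a combination of the functions
    1 / ((t - b_1) ... (t - b_j)). *)
Lemma newton_moments x m q : circle_regular x ->
  (forall i, (i <= m)%N -> disc (b i)) ->
  (forall j, (j <= m)%N -> cint (newton x j.+1) = 0) -> (size q <= m.+1)%N ->
  cint (fun t => reval x t * q.[t] * (\prod_(1 <= i < m.+1) (t - b i))^-1) = 0.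
Proof.
move=> rx; elim: m q => [|m ih] q db hm sq.
  rewrite (size1_polyC sq).
  transitivity (q`_0 * cint (newton x 1)); last by rewrite hm// mulr0.
  rewrite -(cintZ mu1); last by apply: bmeas_newton => // i; rewrite ltnS => /db.
  apply: cint_ext => t ct; rewrite newton1E//; last exact: db.
  by rewrite hornerC; ring.
have mx : bmeas (reval x) by bms.
have sr : (size (q %% ('X - (b m.+1)%:P))%R <= 1)%N.
  by rewrite -ltnS -[X in (_ < X)%N](size_XsubC (b m.+1)) ltn_modp polyXsubC_eq0.
have mn : bmeas (newton x m.+2).
  by apply: bmeas_newton => // i; rewrite ltnS => /db.
have mp : bmeas (fun t => (\prod_(1 <= i < m.+1) (t - b i))^-1).
  by apply: bmeas_prodV => i /andP[_]; rewrite ltnS => im; apply: db; exact: leqW.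
have e := divp_eq q ('X - (b m.+1)%:P).
rewrite (size1_polyC sr) in e.
transitivity (cint (fun t => reval x t * (q %/ ('X - (b m.+1)%:P)).[t]
     * (\prod_(1 <= i < m.+1) (t - b i))^-1)
  + (q %% ('X - (b m.+1)%:P))`_0 * cint (newton x m.+2)); last first.
  rewrite hm// mulr0 addr0; apply: ih => //.
  - by move=> i im; apply: db; exact: leqW.
  - by move=> i im; apply: hm; exact: leqW.
  by rewrite size_divp ?polyXsubC_eq0// size_XsubC leq_subLR.
rewrite -(cintZ mu1)// -(cintD mu1); [|by bms..].
apply: cint_ext => t ct; rewrite newton1E//; last exact: db.
have tm : t - b m.+1 != 0 by apply: circle_neq ct; exact: db.
rewrite [in LHS]e hornerD hornerM hornerXsubC hornerC big_nat_recr//= GRing.invfM.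
move: (q %/ _).[t] (\prod_(_ <= i < _) _)^-1 => u v.
by field.
Qed.

Lemma reval_frac_varpis k q t : (forall j, (1 <= j <= k)%N -> disc (b j)) ->
  circle t ->
  regular (q%:F / (\prod_(1 <= j < k.+1) varpis (b j))%:F) t /\
  reval (q%:F / (\prod_(1 <= j < k.+1) varpis (b j))%:F) t =
    q.[t] * (\prod_(1 <= j < k.+1) (t - b j))^-1.
Proof.
move=> db ct.
have eh : (\prod_(1 <= j < k.+1) varpis (b j)).[t] = \prod_(1 <= j < k.+1) (t - b j).
  by rewrite horner_prod; apply: eq_bigr => j _; rewrite horner_varpis.
have nz : (\prod_(1 <= j < k.+1) varpis (b j)).[t] != 0.
  rewrite eh; rewrite prodf_seq_neq0; apply/allP => j.
  rewrite mem_index_iota ltnS => jk; apply/implyP => _.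
  by apply: circle_neq ct; exact: db.
split; first by exists q, (\prod_(1 <= j < k.+1) varpis (b j)).
by rewrite reval_frac// eh.
Qed.

Lemma perp_newton x m : circle_regular x ->
  (forall j, (j <= m)%N -> disc (b j)) ->
  perp mu x (Lsp b m) -> forall j, (j <= m)%N -> cint (newton x j.+1) = 0.
Proof.
move=> rx db px j jm.
pose q := \prod_(j.+1 <= i < m.+1) varpis (b i).
have sq : (size q <= m.+1)%N.
  rewrite /q (eq_bigr (fun i => 'X - (b i)%:P))//.
  by rewrite -(big_map b xpredT (fun a => 'X - a%:P)) size_prod_XsubC
    size_map size_iota ltnS subSS leq_subr.
pose g : ratfun R := (conj_reverse m q)%:F / (\prod_(1 <= j < m.+1) varpi (b j))%:F.
have Lg : Lsp b m g by exists (conj_reverse m q); rewrite size_conj_reverse.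
rewrite -(px g Lg) /Defs.Lfun; apply: cint_ext => t ct.
rewrite /g substar_Lsp_frac ?size_conj_reverse// conj_reverseK//.
have [rg eg] := @reval_frac_varpis m q t (fun j h => db j (proj2 (andP h))) ct.
rewrite revalM//; last exact: rx.
rewrite eg newton1E//; last exact: db.
have -> : q.[t] = \prod_(j.+1 <= i < m.+1) (t - b i).
  by rewrite horner_prod; apply: eq_bigr => i _; rewrite horner_varpis.
congr (_ * _).
rewrite (@big_cat_nat _ _ _ j.+1 1%N m.+1)//= GRing.invfM mulrCA mulfV ?mulr1//.
rewrite prodf_seq_neq0; apply/allP => i.
rewrite mem_index_iota ltnS => /andP[_ im]; apply/implyP => _.
by apply: circle_neq ct; exact: db.
Qed.

Lemma newton_perp x m : circle_regular x ->
  (forall j, (j <= m)%N -> disc (b j)) ->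
  (forall j, (j <= m)%N -> cint (newton x j.+1) = 0) -> perp mu x (Lsp b m).
Proof.
move=> rx db hm g [p [sp ->]].
rewrite -(@newton_moments x m (conj_reverse m p) rx db hm (size_conj_reverse m p)).
apply: cint_ext => t ct; rewrite substar_Lsp_frac//.
have [rg eg] := @reval_frac_varpis m (conj_reverse m p) t
  (fun j h => db j (proj2 (andP h))) ct.
by rewrite revalM//; [rewrite eg mulrA|exact: rx].
Qed.

Lemma cauchy_wplus x z : cauchy (wplus (b 0%N) x) z = cauchy (newton x 0) z.
Proof.
apply: cint_ext => t _.
by rewrite /newton big_geq// invr1 mulr1 /wplus [in LHS](mulrC (t - _)).
Qed.

Lemma perp_cauchy x m : circle_regular x ->
  (forall j, (j < m)%N -> disc (b j)) -> perp mu x (Lsp_pred b m) ->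
  forall z, disc z -> cauchy (wplus (b 0%N) x) z =
    (\prod_(0 <= i < m) (z - b i)) * cauchy (newton x m) z.
Proof.
move=> rx; case: m => [|m] db px z dz; rewrite cauchy_wplus.
  by rewrite big_geq// mul1r.
by apply: cauchy_newton_zeros => //; exact: perp_newton px.
Qed.

Lemma cauchy_perp x m (K : C -> C) : circle_regular x ->
  (forall j, (j < m)%N -> disc (b j)) ->
  (forall i, (i < m)%N -> cont K (b i)) ->
  (forall l, (l < m)%N -> around (b l) (fun z =>
    cauchy (wplus (b 0%N) x) z = (\prod_(0 <= i < m) (z - b i)) * K z)) ->
  perp mu x (Lsp_pred b m).
Proof.
move=> rx; case: m => [|m] db cK h.
  move=> g ->; rewrite substar0 mulr0 /Defs.Lfun.
  rewrite (@cint_ext _ _ _ (fun=> 0 * 0)).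
    by rewrite (cintZ mu1) ?mul0r//; exact: bmeas_cst.
  by move=> t _; rewrite mulr0 -(rmorph0 (@ratC R)) reval_ratC.
apply: newton_perp => //; apply: (zeros_cauchy_newton rx db cK) => l lm.
by apply: around_mono (h l lm) => z; rewrite cauchy_wplus.
Qed.

End orthogonality.

(** * Liouville's theorem and the recognition of second kind pairs *)

Section liouville.
Context {R : realType}.
Notation C := R[i].
Implicit Types (x y : ratfun R) (z w a t : C) (p q : {poly C}).

Lemma substarK x : substar (substar x) = x.
Proof.
apply: (@ratfun_ext _ _ _ 0); apply: around_almost.
have := almost_reflect (almost_regular (substar x)).
move=> /(almost_and (almost_regular x))/(almost_and (almost_neq 0)).
apply: almost_mono => z [z0 [rx rs]].
have [_ ->] := reval_substar z0 rs.
have w0 : (conjc z)^-1 != 0 by rewrite invr_eq0 fmorph_eq0.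
have e : (conjc (conjc z)^-1)^-1 = z by rewrite conjcV conjc_conjc invrK.
have := @reval_substar _ x _ w0; rewrite e => /(_ rx)[_ ->].
by rewrite conjc_conjc.
Qed.

Lemma regular_outside x a : a != 0 -> regular (substar x) (conjc a)^-1 -> regular x a.
Proof. by move=> a0 rs; rewrite -[x]substarK; case: (reval_substar a0 rs). Qed.

(** Liouville's theorem on the Riemann sphere: without poles in the closed disc
    nor, after reflection, in its exterior, a rational function is constant. *)
Lemma ratfun_liouville x : (forall z, `|z| <= 1 -> regular x z) ->
  (forall z, disc z -> regular (substar x) z) -> exists c, x = ratC c.
Proof.
move=> rin rout.
have rx a : regular x a.
  have [|a1] := boolP (`|a| <= 1); first exact: rin.
  have a1' : 1 < `|a| by rewrite real_ltNge ?normr_real ?real1.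
  have a0 : a != 0 by rewrite -normr_gt0 (lt_trans ltr01).
  apply: regular_outside => //; apply: rout.
  by rewrite /disc/= normfV normcJ invf_lt1// (lt_trans ltr01).
have [p [q [q0 cpq e]]] := ratfun_coprime x.
have sq : size q = 1%N.
  apply/eqP; apply: contraT => /closed_rootP[a /eqP qa].
  by have := rx a; rewrite e => /(regular_coprime q0 cpq); rewrite qa eqxx.
have qc : q = (q`_0)%:P by apply: size1_polyC; rewrite sq.
have c0 : q`_0 != 0 by apply: contra_neq q0 => c0; rewrite qc c0 polyC0.
have {}e : x = ((q`_0)^-1%:P * p)%:F.
  rewrite e [X in _ / X%:F]qc tofracM mulrC; congr (_ * _).
  by rewrite -[LHS](fmorphV (@ratC R)).
move: (_ * p) e => {q q0 cpq sq qc c0} {}p e.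
have sp : (size p <= (size p).-1.+1)%N by rewrite leqSpred.
have [k0|k0] := posnP (size p).-1.
  by exists p`_0; rewrite e /ratC -size1_polyC// (leq_trans sp)// k0.
have /rout := @disc0 R; rewrite e substar_poly (poly_substar_reverse sp).
move=> [u [v [v0]]].
rewrite -tofracXn => /frac_eq; rewrite expf_neq0 ?polyX_eq0//.
move=> /(_ isT (horner_neq0 v0)).
move=> /(congr1 (fun s => s.[0])); rewrite !hornerM hornerXn expr0n.
rewrite (gtn_eqF k0) mulr0 => /eqP; rewrite mulf_eq0 (negbTE v0) orbF.
rewrite horner_coef0 coef_poly subn0/= fmorph_eq0 -/(lead_coef p) lead_coef_eq0.
by move=> /eqP p0; move: k0; rewrite p0 size_poly0.
Qed.

End liouville.

Section converse.
Context {R : realType}.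
Notation C := R[i].
Implicit Types (x y : ratfun R) (z w a t : C) (p q : {poly C}).

Lemma regular_zeta (b z : C) : disc b -> `|z| <= 1 -> regular (zeta b) z.
Proof. by move=> db /(varpi_neq0 db)/reval_zeta[]. Qed.

Lemma reval_zeta_neq0 (b z : C) : disc b -> `|z| <= 1 -> z != b ->
  reval (zeta b) z != 0.
Proof.
move=> db dz zb; have vz := varpi_neq0 db dz; have [_ ->] := reval_zeta vz.
by rewrite !mulf_neq0 ?invr_eq0 -?horner_varpi// ?eta_neq0// subr_eq0.
Qed.

Lemma prod_zeta_neq0 (I : Type) (s : seq I) (b : I -> C) (P : pred I) z :
  (forall i, P i -> disc (b i)) -> `|z| <= 1 -> (forall i, P i -> z != b i) ->
  regular (\prod_(i <- s | P i) zeta (b i)) z /\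
  reval (\prod_(i <- s | P i) zeta (b i)) z != 0.
Proof.
move=> db z1 zb; apply: (big_ind (fun x => regular x z /\ reval x z != 0)).
- by rewrite reval1 oner_neq0; split=> //; exact: regular_ratC 1 z.
- move=> x y [rx nx] [ry ny]; split; first by reg.
  by rewrite revalM// mulf_neq0.
- move=> i Pi; split; first by apply: regular_zeta => //; exact: db.
  by apply: reval_zeta_neq0 => //; [exact: db|exact: zb].
Qed.

Lemma blaschkeE b k : blaschke b k = \prod_(1 <= j < k.+1 | (1 <= j <= k)%N) zeta (b j)
  :> ratfun R.
Proof. by rewrite /blaschke [LHS]big_nat. Qed.

Variable nu : probability (borelC R) R.
Variables (b : nat -> C) (m : nat) (F K K' : C -> C) (G J : ratfun R).
Hypothesis db : forall j, (j <= m)%N -> disc (b j).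
Hypothesis hF : herglotz (b 0%N) F nu.
Hypothesis cF : forall z, disc z -> cont F z.
Hypothesis rG : forall z, `|z| <= 1 -> regular G z.
Hypothesis rJ : forall z, `|z| <= 1 -> regular J z.
Hypothesis rGs : forall z, disc z -> regular (blaschke b m * substar G) z.
Hypothesis rJs : forall z, disc z -> regular (blaschke b m * substar J) z.
Hypothesis cK : forall j, (j <= m)%N -> cont K (b j).
Hypothesis cK' : forall j, (j <= m)%N -> cont K' (b j).
Hypothesis hK : forall j, (j <= m)%N -> around (b j) (fun z =>
  reval G z * F z + reval J z = (\prod_(0 <= i < m) (z - b i)) * K z).
Hypothesis hK' : forall j, (j <= m)%N -> around (b j) (fun z =>
  reval (substar G) z * F z - reval (substar J) z = (z - b 0%N) * K' z).

(** A pair (G, J) is recognized from two interpolation conditions at b_0, ..., b_m.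
    Let y be the function of the second kind of G. By the second condition the
    substar conjugate of J - y has no poles in the disc and vanishes at b_0, while
    J - y has no poles in the closed disc; so J = y by Liouville's theorem. Then
    the first condition says that the Cauchy integral of G vanishes at
    b_0, ..., b_(m-1), which is orthogonality. *)
Lemma perp_second_kind :
  perp nu G (Lsp_pred b m) /\ second_kind nu (b 0%N) G J.
Proof.
have mu1 : nu circle = 1%E by case: hF.
have d0 := db (leq0n m).
have cG : circle_regular G by move=> t /circle_le1/rG.
have dG z : disc z -> regular G z by move=> /disc_le1/rG.
have [y [cy hy hys]] := second_kind_pair d0 hF cG.
have fy := regular_second_kind hF cF cG dG hy.
have cGs := circle_regular_substar cG.
set k2 := kernel_weight (b 0%N) *+ 2.
pose I z := k2 * cauchy nu (wminus (b 0%N) (substar G)) z.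
have cI z : disc z -> cont I z.
  move=> dz; have := cont_cauchy mu1 (bmeas_wminus (b 0%N) cGs) dz => ?.
  by rewrite /I; conts.
have hX z : disc z -> around z (fun w =>
    reval (substar (J - y)) w = reval (substar J) w - reval (substar G) w * F w
    + (w - b 0%N) * I w).
  move=> dz; move: (around_almost z hys).
  move=> /(around_and (around_regular (substar J) z)).
  move=> /(around_and (around_regular (substar y) z)).
  move=> /(around_and (around_disc dz)).
  apply: around_mono => w [dw [ryw [rJw /(_ dw) e]]].
  rewrite substarD substarN revalD//; last by reg.
  by rewrite revalN// e /I -/k2; ring.
(* At the nodes the conjugate of J - y is given by the second condition. *)
have near_b j : (j <= m)%N -> regular (substar (J - y)) (b j) /\
    reval (substar (J - y)) (b j) = (b j - b 0%N) * (I (b j) - K' (b j)).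
  move=> jm; have dj := db jm.
  apply: (regular_around (u := fun w => (w - b 0%N) * (I w - K' w))).
    by have := cI _ dj; have := cK' jm => *; conts.
  apply: around_mono (around_and (hX _ dj) (hK' jm)) => w [-> e].
  by rewrite -[_ - _ * F w]opprB e; ring.
have rXs z : disc z -> regular (substar (J - y)) z.
  move=> dz.
  have [[j jm]|hb] := pselect (exists2 j, (j <= m)%N & z = b j).
    by move=> ->; case: (near_b j jm).
  (* Away from the nodes B_m has no zero, so G_* and J_* have no pole. *)
  have [rB nB] : regular (blaschke b m) z /\ reval (blaschke b m) z != 0.
    rewrite blaschkeE; apply: prod_zeta_neq0.
    - by move=> i /andP[_ im]; exact: db.
    - exact: disc_le1.
    - by move=> i /andP[_ im]; apply/eqP => zb; apply: hb; exists i.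
  have rV x : regular (blaschke b m * x) z -> regular x z.
    move=> h; have := regularM (regularV rB nB) h; rewrite mulKf//.
    apply: contra_neq nB => ->.
    by rewrite -(rmorph0 (@ratC R)) reval_ratC.
  have rGz := rV _ (rGs dz); have rJz := rV _ (rJs dz).
  case: (regular_around (u := fun w => reval (substar J) w
    - reval (substar G) w * F w + (w - b 0%N) * I w) _ (hX z dz)) => //.
  have := cont_reval rGz; have := cont_reval rJz; have := cF dz.
  by have := cI z dz => *; conts.
have rX z : `|z| <= 1 -> regular (J - y) z.
  move=> z1; apply: regularD; first exact: rJ.
  apply: regularN; have [cz|cz] := pselect (circle z); first exact: cy.
  case: (fy z) => //; rewrite /disc/= lt_neqAle z1 andbT.
  exact/eqP.
have [c ec] := ratfun_liouville rX rXs.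
have eJ : J = y.
  have [_] := near_b 0%N (leq0n m).
  rewrite subrr mul0r ec substar_ratC reval_ratC => /eqP; rewrite fmorph_eq0.
  by move=> /eqP c0; move/eqP: ec; rewrite c0 rmorph0 subr_eq0 => /eqP.
split; last first.
  move=> z dz; rewrite eJ; have [_ ->] := fy z dz.
  by rewrite (second_kind_formula d0 hF).
pose v z := k2 * (1 - conjc (b 0%N) * z).
have v0 z : disc z -> v z != 0.
  move=> dz; rewrite /v /k2 -mulr_natl !mulf_neq0 ?pnatr_eq0//.
    by rewrite invr_eq0 kernel_weight_neq0.
  by rewrite -horner_varpi varpi_neq0// disc_le1.
apply: (@cauchy_perp _ _ mu1 b G m (fun z => K z / v z)) => //.
- by move=> j jm; apply: db; exact: ltnW.
- move=> j jm; have dj := db (ltnW jm).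
  have := cK (ltnW jm) => ?; rewrite /v; conts.
  exact: v0 dj.
move=> l lm; have dl := db (ltnW lm).
apply: around_mono (around_and (around_disc dl) (hK (ltnW lm))) => z [dz].
have [_ ez] := fy z dz; rewrite eJ ez addrC subrK -/k2 -/(v z) => e.
by apply: (mulfI (v0 z dz)); rewrite e; field; exact: v0.
Qed.

End converse.

(** * Products of Blaschke factors *)

Section field_identities.
Variable F : fieldType.
Implicit Types a c e h v w X : F.

Lemma zeta_substar_identity h X v w : h != 0 -> X != 0 -> v != 0 -> w != 0 ->
  h^-1 * (v / X) / (w / X) = (h * w / v)^-1.
Proof. by move=> *; field; apply/and4P. Qed.

Lemma PN_substar_identity a c X v0 w0 vN wN :
  c != 0 -> X != 0 -> vN != 0 -> wN != 0 ->
  a * (w0 / X) * (v0 / X) / (c * (wN / X) * (vN / X)) =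
  a * v0 * w0 / (c * vN * wN).
Proof. by move=> *; field; apply/and4P. Qed.

Lemma PN_unit_identity c e0 eN a0 aN v0 w0 vN wN :
  c != 0 -> eN != 0 -> a0 != 0 -> aN != 0 -> v0 != 0 -> w0 != 0 ->
  vN != 0 -> wN != 0 ->
  e0 * w0 / v0 / (c * (aN * v0 * w0 / (a0 * vN * wN)) * (eN * wN / vN)) =
  e0 * a0 / (aN * c * eN) * vN ^+ 2 / v0 ^+ 2.
Proof. by move=> c0 h1 h2 h3 h4 h5 h6 h7; field; rewrite c0 h1 h2 h3 h4 h5 h6 h7. Qed.

End field_identities.

Section zeta_products.
Context {R : realType}.
Notation C := R[i].
Implicit Types (x y : ratfun R) (z w a t : C) (p q : {poly C}).

Lemma varpis_poly_neq0 (b : C) : varpis b != 0 :> {poly C}.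
Proof. by rewrite /varpis polyXsubC_eq0. Qed.

Lemma zeta_neq0 (b : C) : zeta b != 0.
Proof.
rewrite /zeta; apply: mulf_neq0; last first.
  by rewrite invr_eq0; exact/tofrac_neq0/varpi_poly_neq0.
by apply: mulf_neq0; [exact/ratC_neq0/eta_neq0|exact/tofrac_neq0/varpis_poly_neq0].
Qed.

(** This is zeta_0 B_(k-1) for every k, the convention B_(-1) = 1 / zeta_0 being
    what makes k = 0 fit: see zeta_blaschke_pred. *)
Definition zeta_prod (b : nat -> C) k : ratfun R := \prod_(0 <= j < k) zeta (b j).

Lemma zeta_prod_neq0 b k : zeta_prod b k != 0.
Proof.
rewrite prodf_seq_neq0; apply/allP => i _; apply/implyP => _.
exact: zeta_neq0.
Qed.

Lemma blaschke_neq0 (b : nat -> C) k : blaschke b k != 0.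
Proof.
rewrite prodf_seq_neq0; apply/allP => i _; apply/implyP => _.
exact: zeta_neq0.
Qed.

Lemma zeta_blaschke b k : zeta (b 0%N) * blaschke b k = zeta_prod b k.+1.
Proof. by rewrite /zeta_prod big_ltn. Qed.

Lemma zeta_blaschke_pred b k : zeta (b 0%N) * blaschke_pred b k = zeta_prod b k.
Proof.
case: k => [|k]; last exact: zeta_blaschke.
by rewrite /zeta_prod big_geq// divff// zeta_neq0.
Qed.

Lemma continued_le N (b h : nat -> C) j : (j <= N)%N -> continued N b h j = b j.
Proof. by rewrite /continued => ->. Qed.

Lemma continued_add N (b h : nat -> C) j : h 0%N = b N -> continued N b h (N + j) = h j.
Proof.
move=> hb; rewrite /continued -{2}[N]addn0 leq_add2l leqn0.
by case: eqP => [->|_]; [rewrite addn0|rewrite addKn].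
Qed.

Lemma continued_disc N n (b h : nat -> C) :
  (forall j, (j <= N)%N -> disc (b j)) -> (forall j, disc (h j)) ->
  forall j, (j <= N + n)%N -> disc (continued N b h j).
Proof.
by move=> db dh j _; rewrite /continued; case: ifP => [/db|_]; last exact: dh.
Qed.

(** The node h_0 = b_N is counted once in the second factor, which absorbs the
    index shift between B_N and zeta_0 B_(N-1). *)
Lemma zeta_prod_continued N (b h : nat -> C) k : h 0%N = b N ->
  zeta_prod (continued N b h) (N + k) = zeta_prod b N * zeta_prod h k.
Proof.
move=> hb; rewrite /zeta_prod (@big_cat_nat _ _ _ N)//= ?leq_addr//.
congr (_ * _).
  by apply: eq_big_nat => j /andP[_ jN]; rewrite continued_le// ltnW.
rewrite -{1}[N]add0n big_addn addKn.
by apply: eq_bigr => j _; rewrite addnC continued_add.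
Qed.

Lemma blaschke_continued N (b h : nat -> C) k : h 0%N = b N ->
  blaschke (continued N b h) (N + k) = blaschke b N * blaschke h k.
Proof.
move=> hb; apply: (mulfI (zeta_neq0 (b 0%N))).
rewrite [LHS](zeta_blaschke (continued N b h)) mulrA (zeta_blaschke b).
rewrite -addnS zeta_prod_continued// -(zeta_blaschke h) hb.
by rewrite {2}/zeta_prod big_nat_recr//= mulrA.
Qed.

(** The factors by which the Blaschke products differ from the polynomial with
    the same zeros in the disc. *)
Definition zeta_units (b : nat -> C) k z :=
  \prod_(0 <= i < k) (Defs.eta (b i) / (1 - conjc (b i) * z)).

Lemma reval_zeta_prod b k z : (forall j, (j < k)%N -> disc (b j)) -> `|z| <= 1 ->
  regular (zeta_prod b k) z /\
  reval (zeta_prod b k) z = (\prod_(0 <= i < k) (z - b i)) * zeta_units b k z.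
Proof.
move=> + z1; rewrite /zeta_prod /zeta_units.
elim: k => [|k ih] db.
  by rewrite !big_geq// mulr1 reval1; split => //; exact: regular_ratC 1 z.
have [rk ek] := ih (fun j h => db j (ltnW h)).
have vz := varpi_neq0 (db k (ltnSn k)) z1.
have [rz ez] := reval_zeta vz.
rewrite !big_nat_recr//=; split; first by reg.
by rewrite revalM// ek ez; move: vz; rewrite horner_varpi => vz; field.
Qed.

Lemma cont_zeta_units b k z : (forall j, (j < k)%N -> disc (b j)) -> disc z ->
  cont (zeta_units b k) z.
Proof.
move=> + dz; elim: k => [|k ih] db.
  rewrite (_ : zeta_units b 0 = fun=> 1); first exact: cont_cst.
  by apply/funext => w; rewrite /zeta_units big_geq.
have vz := varpi_neq0 (db k (ltnSn k)) (disc_le1 dz).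
have ck := ih (fun j h => db j (ltnW h)).
rewrite (_ : zeta_units b k.+1 = fun z => zeta_units b k z *
  (Defs.eta (b k) / (1 - conjc (b k) * z))); last first.
  by apply/funext => w; rewrite /zeta_units big_nat_recr.
by conts; rewrite -horner_varpi.
Qed.

Lemma zeta_units_neq0 b k z : (forall j, (j < k)%N -> disc (b j)) -> disc z ->
  zeta_units b k z != 0.
Proof.
move=> db dz; rewrite /zeta_units prodf_seq_neq0; apply/allP => j.
rewrite mem_index_iota => /db dj; apply/implyP => _.
by rewrite mulf_neq0 ?eta_neq0// invr_eq0 -horner_varpi varpi_neq0// disc_le1.
Qed.

Lemma zeta_prod_nonzero b k z : (forall j, (j < k)%N -> disc (b j)) ->
  `|z| <= 1 -> (forall j, (j < k)%N -> z != b j) -> reval (zeta_prod b k) z != 0.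
Proof.
move=> db z1 zb; rewrite /zeta_prod big_nat; apply: (prod_zeta_neq0 _ _ z1 _).2.
  by move=> i /andP[_]; exact: db.
by move=> i /andP[_]; exact: zb.
Qed.

Lemma substar_varpis (b : C) :
  substar (varpis b)%:F = (varpi b)%:F / 'X%:F :> ratfun R.
Proof.
rewrite /varpis /varpi -mul_polyC !tofracB tofracM tofrac1.
rewrite substarD substarN substarX -[b%:P%:F]/(ratC b) substar_ratC.
by rewrite mulrBl mul1r mulfK// X_neq0.
Qed.

Lemma substar_zeta (b : C) : substar (zeta b) = (zeta b)^-1.
Proof.
rewrite /zeta !substarM substarV substar_ratC substar_varpi substar_varpis.
have e : ratC (conjc (Defs.eta b)) = (ratC (Defs.eta b))^-1 :> ratfun R.
  rewrite -[RHS](fmorphV (@ratC R)); congr (ratC _).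
  by apply: (mulfI (eta_neq0 b)); rewrite eta_norm divff ?eta_neq0.
rewrite e; apply: zeta_substar_identity.
- exact/ratC_neq0/eta_neq0.
- exact: X_neq0.
- exact/tofrac_neq0/varpi_poly_neq0.
- exact/tofrac_neq0/varpis_poly_neq0.
Qed.

Lemma substar_blaschke (b : nat -> C) k : substar (blaschke b k) = (blaschke b k)^-1.
Proof.
rewrite /blaschke substar_prod -prodfV.
by apply: eq_bigr => i _; exact: substar_zeta.
Qed.

Lemma PN_neq0 (b0 bN : C) : disc b0 -> disc bN -> PN b0 bN != 0.
Proof.
move=> d0 dN; have vb b : disc b -> ratC (varpi b).[b] != 0 :> ratfun R.
  by move=> db; rewrite ratC_neq0// varpi_neq0// disc_le1.
have v3 (b b' b'' : C) : disc b' ->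
    ratC (varpi b').[b'] * (varpi b)%:F * (varpis b'')%:F != 0 :> ratfun R.
  move=> db; apply: mulf_neq0; last exact/tofrac_neq0/varpis_poly_neq0.
  by apply: mulf_neq0; [exact: vb|exact/tofrac_neq0/varpi_poly_neq0].
by apply: mulf_neq0; [|rewrite invr_eq0]; exact: v3.
Qed.

Lemma substar_PN (b0 bN : C) : disc b0 -> substar (PN b0 bN) = PN b0 bN.
Proof.
move=> d0; have vb b : conjc (varpi b).[b] = (varpi b).[b].
  by rewrite horner_varpi !conjcE mulrC.
rewrite /PN !(substarM, substarV) !substar_ratC !vb.
rewrite !substar_varpi !substar_varpis.
apply: PN_substar_identity.
- by rewrite ratC_neq0// varpi_neq0// disc_le1.
- exact: X_neq0.
- exact/tofrac_neq0/varpi_poly_neq0.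
- exact/tofrac_neq0/varpis_poly_neq0.
Qed.

(** The common factor of the new functions is a unit near the closed disc: in
    zeta_0 / (P_N zeta_N) the zeros at beta_0, beta_N and the poles cancel. *)
Lemma PN_unit (b0 bN : C) (c : C) : disc b0 -> disc bN -> c != 0 ->
  exists k : C,
  zeta b0 / (ratC c * PN b0 bN * zeta bN) =
    ratC k * (varpi bN)%:F ^+ 2 / (varpi b0)%:F ^+ 2.
Proof.
move=> d0 dN c0.
have vb b : disc b -> (varpi b).[b] != 0 by move=> db; rewrite varpi_neq0// disc_le1.
exists (Defs.eta b0 * (varpi b0).[b0] / ((varpi bN).[bN] * c * Defs.eta bN)).
rewrite (fmorph_div (@ratC R)) !(rmorphM (@ratC R)) /PN /zeta.
apply: PN_unit_identity.
- exact: ratC_neq0.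
- exact/ratC_neq0/eta_neq0.
- by apply: ratC_neq0; exact: vb.
- by apply: ratC_neq0; exact: vb.
- exact/tofrac_neq0/varpi_poly_neq0.
- exact/tofrac_neq0/varpis_poly_neq0.
- exact/tofrac_neq0/varpi_poly_neq0.
- exact/tofrac_neq0/varpis_poly_neq0.
Qed.

End zeta_products.

(** * The transformation of a pair by A, B, C, D *)

Lemma cancel_middle (F : fieldType) (e w v q : F) : w != 0 ->
  e * w / v * (q / w) = e * (q / v).
Proof.
move=> w0; transitivity (e * (q / v) * (w / w)); last by rewrite divff ?mulr1.
by rewrite mulrACA [RHS]mulrACA [in RHS]mulrA !mulrA; congr (_ / w); ring.
Qed.

Section spaces.
Context {R : realType}.
Notation C := R[i].
Implicit Types (x y : ratfun R) (z w a t : C) (p q : {poly C}).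

Lemma regular_prod_varpi (b : nat -> C) k p z :
  (forall j, (j <= k)%N -> disc (b j)) -> `|z| <= 1 ->
  regular (p%:F / (\prod_(1 <= j < k.+1) varpi (b j))%:F) z.
Proof.
move=> db z1; exists p, (\prod_(1 <= j < k.+1) varpi (b j)); split => //.
rewrite horner_prod prodf_seq_neq0; apply/allP => j.
rewrite mem_index_iota ltnS => /andP[_ jk]; apply/implyP => _.
by apply: varpi_neq0 => //; exact: db.
Qed.

Lemma regular_Lsp (b : nat -> C) k x z : (forall j, (j <= k)%N -> disc (b j)) ->
  Lsp b k x -> `|z| <= 1 -> regular x z.
Proof. by move=> db [p [_ ->]]; exact: regular_prod_varpi. Qed.

Lemma blaschke_frac (b : nat -> C) k : exists e : C,
  blaschke b k = ratC e * (\prod_(1 <= j < k.+1) varpis (b j))%:F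
    / (\prod_(1 <= j < k.+1) varpi (b j))%:F.
Proof.
rewrite /blaschke; elim: k => [|k [e ih]].
  by exists 1; rewrite !big_geq// !tofrac1 divr1 mulr1.
exists (e * Defs.eta (b k.+1)).
rewrite big_nat_recr//= ih /zeta mulf_div [in RHS]big_nat_recr//=.
rewrite [in X in _ = _ / X]big_nat_recr//=.
by rewrite !tofracM (rmorphM (@ratC R)) mulrACA.
Qed.

(** The poles of x_* for x in L_k are among b_1, ..., b_k, where B_k vanishes. *)
Lemma regular_superstar (b : nat -> C) k x z : (forall j, (j <= k)%N -> disc (b j)) ->
  Lsp b k x -> `|z| <= 1 -> regular (blaschke b k * substar x) z.
Proof.
move=> db [p [sp ->]] z1; rewrite substar_Lsp_frac//.
have [e ->] := blaschke_frac b k.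
rewrite cancel_middle; last first.
  apply: tofrac_neq0; rewrite prodf_seq_neq0; apply/allP => j _.
  by apply/implyP => _; exact: varpis_poly_neq0.
apply: regularM; first by reg.
exact: regular_prod_varpi.
Qed.

End spaces.

Section transformation.
Context {R : realType}.
Notation C := R[i].
Implicit Types (x y p s T : ratfun R) (z w a t : C).
Variables (N r : nat) (beta tbeta : nat -> C) (F tF f g : C -> C).
Variables (A B C' D U : ratfun R).
Local Notation W := (zeta_prod beta N).
Local Notation V := (zeta_prod tbeta r).
Hypothesis dbeta : forall j, (j <= N)%N -> disc (beta j).
Hypothesis dtbeta : forall j, (j <= r)%N -> disc (tbeta j).
Hypothesis cF : forall z, disc z -> cont F z.
Hypothesis cf : forall z, disc z -> cont f z.
Hypothesis cg : forall z, disc z -> cont g z.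
Hypothesis rA : forall z, disc z -> regular A z.
Hypothesis rB : forall z, disc z -> regular B z.
Hypothesis rC : forall z, disc z -> regular C' z.
Hypothesis rD : forall z, disc z -> regular D z.
Hypothesis rU : forall z, disc z -> regular U z.
Hypothesis hABF : forall z, disc z ->
  reval A z - reval B z * F z = reval W z * g z.
Hypothesis hdet : forall z, disc z ->
  reval (A * D - B * C') z = reval (W * V) z * f z.
Hypothesis hB : forall j, (j < N)%N -> reval B (beta j) != 0.
Hypothesis htF : forall z, disc z -> reval A z - reval B z * F z != 0 ->
  tF z = (- reval C' z + reval D z * F z) / (reval A z - reval B z * F z).
Variables (p s T : ratfun R) (h : C -> C).
Hypothesis rp : forall z, disc z -> regular p z.
Hypothesis rs : forall z, disc z -> regular s z.
Hypothesis rT : forall z, disc z -> regular T z.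
Hypothesis ch : forall z, disc z -> cont h z.
Hypothesis hps : forall z, disc z ->
  reval p z * F z + reval s z = reval W z * reval T z * h z.

(** For U = W / (c P_N B_N) the functions transform A B and transform C D are G and
    J when p = phi and s = psi, and the superstar conjugates of G and - J up to a
    unimodular constant when p = phi^* and s = - psi^*. *)
Definition transform x y := U * (p * x + s * y) / W.

Let rW z : disc z -> regular W z.
Proof.
by move=> dz; apply: (reval_zeta_prod (fun j jN => dbeta (ltnW jN)) (disc_le1 dz)).1.
Qed.
Let rV z : disc z -> regular V z.
Proof.
by move=> dz; apply: (reval_zeta_prod (fun j jN => dtbeta (ltnW jN)) (disc_le1 dz)).1.
Qed.

Lemma reval_transform x y z : disc z -> reval W z != 0 -> regular x z -> regular y z ->
  regular (transform x y) z /\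
  reval (transform x y) z =
    reval U z * (reval p z * reval x z + reval s z * reval y z) / reval W z.
Proof.
move=> dz nW rx ry.
have rWV := regularV (rW dz) nW.
have rpz := rp dz; have rsz := rs dz; have rUz := rU dz; have rWz := rW dz.
rewrite /transform.
split; first by reg.
rewrite revalM; [|by reg..]; rewrite revalM; [|by reg..].
by rewrite revalD; [|by reg..]; rewrite !revalM// revalV.
Qed.

Lemma around_good z : disc z -> around z (fun w => disc w /\ reval W w != 0).
Proof.
move=> dz; apply: around_and (around_disc dz) _.
exact/around_almost/almost_neq0/zeta_prod_neq0.
Qed.

Lemma hdetE z : disc z -> reval A z * reval D z - reval B z * reval C' z =
  reval W z * reval V z * f z.
Proof.
move=> dz; have hd := hdet dz.
have := rA dz; have := rB dz; have := rC dz; have := rD dz.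
have := rW dz; have := rV dz => *; move: hd.
rewrite revalD; [|by reg..]; rewrite revalN; last by reg.
by rewrite !revalM// => <-.
Qed.

(** From p A + s B = p (A - B F) + B (p F + s), where both terms contain the factor
    W that is divided out. *)
Lemma transform_AB_regular z : disc z -> regular (transform A B) z /\
  reval (transform A B) z = reval U z *
    (reval p z * g z + reval B z * reval T z * h z).
Proof.
move=> dz; apply: (regular_around (u := fun z => reval U z *
    (reval p z * g z + reval B z * reval T z * h z))).
  have := cont_reval (rU dz); have := cont_reval (rp dz).
  have := cont_reval (rB dz); have := cont_reval (rT dz).
  by have := cg dz; have := ch dz => *; conts.
apply: around_mono (around_good dz) => w [dw nW].
have [_ ->] := reval_transform dw nW (rA dw) (rB dw).
rewrite -[RHS](mulfK nW); congr (_ / _); rewrite -[RHS]mulrA; congr (_ * _).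
have -> : reval s w = reval W w * reval T w * h w - reval p w * F w.
  by rewrite -hps// addrC addKr.
have -> : reval A w = reval W w * g w + reval B w * F w.
  by rewrite -hABF// subrK.
by ring.
Qed.

(** By Cramer's rule B J = D G - p U V f for G = transform A B and
    J = transform C D, so that J can have a pole only where B vanishes. There W does
    not vanish, by the hypothesis on the values of B at the points beta. *)
Lemma transform_CD_regular z : disc z -> regular (transform C' D) z.
Proof.
move=> dz; have [B0|B0] := eqVneq (reval B z) 0; last first.
  case: (@regular_around R (transform C' D) (fun z =>
    (reval D z * reval (transform A B) z
      - reval p z * reval U z * reval V z * f z) / reval B z) z) => //.
    have := cont_reval (rU dz); have := cont_reval (rp dz).
    have := cont_reval (rB dz); have := cont_reval (rD dz).
    have := cont_reval (rV dz); have := cf dz.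
    by have := cont_reval (transform_AB_regular dz).1 => *; conts.
  apply: around_mono (around_and (around_good dz)
    (around_neq0 (cont_reval (rB dz)) B0)) => w [[dw nW] nB].
  have [_ ->] := reval_transform dw nW (rC dw) (rD dw).
  have [_ ->] := reval_transform dw nW (rA dw) (rB dw).
  have e : reval V w * f w =
      (reval A w * reval D w - reval B w * reval C' w) / reval W w.
    by rewrite hdetE//; field.
  by rewrite -[_ * reval V w * f w]mulrA e; field; rewrite nW nB.
suff nW : reval W z != 0 by case: (reval_transform dz nW (rC dz) (rD dz)).
apply: zeta_prod_nonzero; first by move=> j /ltnW/dbeta.
  exact: disc_le1.
by move=> j jN; apply: contra_eq_neq B0 => ->; exact: hB.
Qed.

(** Substituting tF = (- C + D F) / (A - B F) gives
    (A D - B C) (p F + s) / (A - B F), up to the factor U / W. *)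
Lemma transform_pair z : disc z -> g z != 0 -> around z (fun w =>
  reval (transform A B) w * tF w + reval (transform C' D) w =
  reval U w * reval V w * reval T w * (h w * f w / g w)).
Proof.
move=> dz g0.
apply: around_mono (around_and (around_good dz) (around_neq0 (cg dz) g0)).
move=> w [[dw nW] ng].
have [_ ->] := reval_transform dw nW (rC dw) (rD dw).
have [_ ->] := reval_transform dw nW (rA dw) (rB dw).
have nAB : reval A w - reval B w * F w != 0 by rewrite hABF// mulf_neq0.
rewrite htF//.
transitivity (reval U w * (reval A w * reval D w - reval B w * reval C' w) *
  (reval p w * F w + reval s w) / (reval W w * (reval A w - reval B w * F w))).
  by field; rewrite nW nAB.
by rewrite hdetE// hps// hABF//; field; rewrite nW ng.
Qed.

End transformation.

(** * The two factorizations of the original pair, and the reflected pair *)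

Section forward.
Context {R : realType}.
Notation C := R[i].
Implicit Types (x y : ratfun R) (z w a t : C) (p q : {poly C}).
Variable mu : probability (borelC R) R.
Variables (b : nat -> C) (k : nat) (F : C -> C) (phi psi : ratfun R).
Hypothesis db : forall j, (j <= k)%N -> disc (b j).
Hypothesis hF : herglotz (b 0%N) F mu.
Hypothesis cF : forall z, disc z -> cont F z.
Hypothesis phi_L : Lsp b k phi.
Hypothesis psi_def : second_kind mu (b 0%N) phi psi.
Local Notation phis := (blaschke b k * substar phi).
Local Notation psis := (blaschke b k * substar psi).

Let mu1 : mu circle = 1%E. Proof. by case: hF. Qed.
Let d0 : disc (b 0%N). Proof. exact: db. Qed.
Let rphi z : `|z| <= 1 -> regular phi z.
Proof. by move=> z1; exact: regular_Lsp db phi_L z1. Qed.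
Let cphi : circle_regular phi. Proof. by move=> t /circle_le1/rphi. Qed.
Let dphi z : disc z -> regular phi z. Proof. by move=> /disc_le1/rphi. Qed.

Lemma psi_regular :
  [/\ circle_regular psi,
   forall z, disc z -> regular psi z /\ reval psi z =
    kernel_weight (b 0%N) *+ 2 * (1 - conjc (b 0%N) * z) * cauchy mu (wplus (b 0%N) phi) z
    - reval phi z * F z &
   almost (fun z => disc z -> reval (substar psi) z =
      reval (substar phi) z * F z - kernel_weight (b 0%N) *+ 2 * (z - b 0%N)
      * cauchy mu (wminus (b 0%N) (substar phi)) z)].
Proof.
have [y [cy hy hys]] := second_kind_pair d0 hF cphi.
have e := second_kind_unique d0 hF psi_def cphi hy.
rewrite e; split => //.
exact: (regular_second_kind hF cF cphi dphi hy).
Qed.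

(** The zeros of phi F + psi are those of the Cauchy integral of (t - b_0) phi, and
    stem from the orthogonality of phi to L_(k-1). *)
Lemma phi_factor : perp mu phi (Lsp_pred b k) ->
  exists h : C -> C, (forall z, disc z -> cont h z) /\
  forall z, disc z -> reval phi z * F z + reval psi z = reval (zeta_prod b k) z * h z.
Proof.
move=> phi_perp; have [_ hpsi _] := psi_regular.
have dbk j : (j < k)%N -> disc (b j) by move=> /ltnW/db.
exists (fun z => kernel_weight (b 0%N) *+ 2 * (1 - conjc (b 0%N) * z) *
  cauchy mu (newton b phi k) z / zeta_units b k z); split => [z dz|z dz].
  have cz := cont_zeta_units dbk dz; have nz := zeta_units_neq0 dbk dz.
  have := cont_cauchy mu1 (bmeas_newton cphi dbk) dz => ?.
  by conts.
have [_ ->] := reval_zeta_prod dbk (disc_le1 dz).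
have [_ ->] := hpsi z dz; have nz := zeta_units_neq0 dbk dz.
by rewrite (perp_cauchy mu1 cphi dbk phi_perp dz); field.
Qed.

(** In phi_* F - psi_* the kernel D - 1 contributes the factor zeta_0, and
    multiplication by B_k contributes the other zeros. *)
Lemma superstar_factor : (forall z, disc z -> regular psis z) /\
  exists h : C -> C, (forall z, disc z -> cont h z) /\
  forall z, disc z -> reval phis z * F z + reval (- psis) z =
    reval (zeta_prod b k.+1) z * h z.
Proof.
have [cpsi _ hpsis] := psi_regular.
pose h z := kernel_weight (b 0%N) *+ 2 * (1 - conjc (b 0%N) * z) / Defs.eta (b 0%N) *
  cauchy mu (wminus (b 0%N) (substar phi)) z.
have ch z : disc z -> cont h z.
  move=> dz; have := bmeas_wminus (b 0%N) (circle_regular_substar cphi).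
  by move=> /(cont_cauchy mu1)/(_ dz) => ?; rewrite /h; conts.
have rphis z : disc z -> regular phis z.
  by move=> dz; apply: regular_superstar phi_L (disc_le1 dz).
have rzp z : disc z -> regular (zeta_prod b k.+1) z.
  by move=> dz; apply: (reval_zeta_prod _ (disc_le1 dz)).1 => j; exact: db.
have rpsis z : disc z -> regular psis z /\ reval psis z =
    reval phis z * F z - reval (zeta_prod b k.+1) z * h z.
  move=> dz; apply: (regular_around (u := fun z =>
    reval phis z * F z - reval (zeta_prod b k.+1) z * h z)).
    have := ch z dz; have := cF dz; have := cont_reval (rphis z dz).
    by have := cont_reval (rzp z dz) => *; conts.
  move: (around_almost z hpsis).
  move=> /(around_and (around_regular (substar psi) z)).
  move=> /(around_and (around_regular (substar phi) z)).
  move=> /(around_and (around_disc dz)).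
  apply: around_mono => w [dw [rp [rs /(_ dw) e]]].
  have vw := varpi_neq0 d0 (disc_le1 dw).
  have [rz ez] := reval_zeta vw.
  have rB : regular (blaschke b k) w.
    rewrite blaschkeE; apply: regular_prod => j /andP[_ jk].
    by apply: regular_zeta; [exact: db|exact: disc_le1].
  rewrite -zeta_blaschke (revalM rB rs) (revalM rB rp) (revalM rz rB) e ez /h.
  move: vw; rewrite horner_varpi => vw; have e0 := eta_neq0 (b 0%N).
  by field; rewrite vw e0.
split=> [z dz|]; first by case: (rpsis z dz).
exists h; split => // z dz; have [rp ep] := rpsis z dz.
by rewrite revalN// ep; ring.
Qed.

End forward.

Section reflected_identities.
Variable F : fieldType.
Implicit Types c P W z : F.

Lemma unit_identity W zN z0 BN c P : zN != 0 -> BN != 0 -> c != 0 -> P != 0 ->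
  W * zN = z0 * BN -> W / (c * P * BN) = z0 / (c * P * zN).
Proof.
move=> zN0 B0 c0 P0 e; apply/eqP; rewrite GRing.eqr_div ?mulf_neq0//.
by rewrite mulrCA e; apply/eqP; ring.
Qed.

Lemma quotient_identity W BN c P u : W != 0 ->
  u / (c * P * BN) = W / (c * P * BN) * u / W.
Proof. by move=> W0; rewrite [RHS]mulrAC [W / _]mulrC mulfK// mulrC. Qed.

Lemma reflect_identity t A B BN Bt Bh p q c P W :
  BN != 0 -> Bt != 0 -> c != 0 -> P != 0 -> W != 0 ->
  Bt * Bh * ((p * (t * A / (BN * Bt)) + q * (- t * B / (BN * Bt))) /
     (c * P * BN^-1)) =
  t * (W / (c * P * BN) * (BN * Bh * p * A + - (BN * Bh * q) * B) / W).
Proof. by move=> b0 t0 c0 p0 w0; field; rewrite b0 t0 c0 p0 w0. Qed.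

End reflected_identities.

Section reflection.
Context {R : realType}.
Notation C := R[i].
Variables (N r : nat) (beta tbeta : nat -> C) (c : R).

Lemma substar_of_superstar (x : ratfun R) (tau : C) : tau != 0 ->
  superstar beta N tbeta r x / x = ratC tau ->
  substar x = ratC tau * x / (blaschke beta N * blaschke tbeta r).
Proof.
move=> t0 e.
have x0 : x != 0.
  apply: contra_neq (ratC_neq0 t0) => x0.
  by rewrite -e x0 invr0 mulr0.
have u0 : blaschke beta N * blaschke tbeta r != 0 :> ratfun R.
  by apply: mulf_neq0; exact: blaschke_neq0.
have -> : ratC tau * x = superstar beta N tbeta r x by rewrite -e (divfK x0).
by rewrite /superstar mulrC (mulKf u0).
Qed.

Definition pair_denominator : ratfun R :=
  ratC c%:C * PN (beta 0%N) (beta N) * blaschke beta N.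

(** P_N is real on the circle, hence its own conjugate, and the conjugates of A and
    B are multiples of A and B with opposite constants: so the superstar conjugate
    of G is formed like G, from phi^* and - psi^*. *)
Lemma substar_pair (phi psi A B Bh : ratfun R) (tau : C) :
  disc (beta 0%N) -> disc (beta N) -> c != 0 -> tau != 0 ->
  superstar beta N tbeta r A / A = ratC tau ->
  superstar beta N tbeta r B / B = ratC (- tau) ->
  blaschke tbeta r * Bh * substar ((phi * A + psi * B) / pair_denominator) =
  ratC tau * transform N beta (zeta_prod beta N / pair_denominator)
    (blaschke beta N * Bh * substar phi) (- (blaschke beta N * Bh * substar psi))
    A B.
Proof.
move=> d0 dN c0 t0 eA eB.
have nt0 : - tau != 0 by rewrite oppr_eq0.
have ed : substar pair_denominator =
    ratC c%:C * PN (beta 0%N) (beta N) * (blaschke beta N)^-1.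
  rewrite /pair_denominator substarM substar_blaschke; congr (_ * _).
  rewrite substarM (substar_PN _ d0); congr (_ * _).
  by rewrite substar_ratC; congr (ratC _); exact: conjc_real.
rewrite (substarM (phi * A + psi * B)) substarV ed substarD.
rewrite (substarM phi) (substarM psi) (substar_of_superstar t0 eA).
rewrite (substar_of_superstar nt0 eB) (rmorphN (@ratC R)) /transform.
apply: reflect_identity.
- exact: blaschke_neq0.
- exact: blaschke_neq0.
- by apply: ratC_neq0; rewrite fmorph_eq0.
- exact: PN_neq0.
- exact: zeta_prod_neq0.
Qed.

Lemma regular_unit_factor z : disc (beta 0%N) -> disc (beta N) -> c != 0 ->
  `|z| <= 1 -> regular (zeta_prod beta N / pair_denominator) z.
Proof.
move=> d0 dN c0 z1; rewrite /pair_denominator.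
have c1 : c%:C != 0 :> C by rewrite fmorph_eq0.
rewrite (@unit_identity _ _ (zeta (beta N)) (zeta (beta 0%N))); last first.
- by rewrite zeta_blaschke /zeta_prod [RHS]big_nat_recr.
- exact: PN_neq0.
- exact: ratC_neq0.
- exact: blaschke_neq0.
- exact: zeta_neq0.
have [k ->] := PN_unit d0 dN c1.
have v0 := varpi_neq0 d0 z1.
apply: regularM; first by rewrite expr2; reg.
apply: regularV; rewrite expr2; first by reg.
by rewrite revalM; [rewrite reval_poly mulf_neq0|reg|reg].
Qed.

End reflection.

(** * The spectral transformation *)

Theorem theorem10 (R : realType)
  (N n r : nat)
  (beta hbeta tbeta : nat -> R[i])
  (beta_disc : forall j, (j <= N)%N -> disc (beta j))
  (hbeta_disc : forall j, disc (hbeta j))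
  (tbeta_disc : forall j, (j <= r)%N -> disc (tbeta j))
  (hbeta0 : hbeta 0%N = beta N)
  (F : R[i] -> R[i])
  (F_C : C_function F)
  (F_beta0 : F (beta 0%N) = 1)
  (mu : probability (borelC R) R)
  (mu_F : herglotz (beta 0%N) F mu)
  (mu_pos : positive_definite mu (continued N beta hbeta))
  (phi psi : ratfun R)
  (phi_L : Lsp (continued N beta hbeta) (N + n) phi)
  (phi_neq0 : phi != 0)
  (phi_perp : perp mu phi (Lsp_pred (continued N beta hbeta) (N + n)))
  (psi_def : second_kind mu (beta 0%N) phi psi)
  (tbeta_r : tbeta r = beta N)
  (A B C D : ratfun R)
  (A_L : Lmul (Lsp beta N) (Lsp tbeta r) A)
  (B_L : Lmul (Lsp beta N) (Lsp tbeta r) B)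
  (C_L : Lmul (Lsp beta N) (Lsp tbeta r) C)
  (D_L : Lmul (Lsp beta N) (Lsp tbeta r) D)
  (A_self : self_reciprocal beta N tbeta r A)
  (B_self : self_reciprocal beta N tbeta r B)
  (C_self : self_reciprocal beta N tbeta r C)
  (D_self : self_reciprocal beta N tbeta r D)
  (tauA : R[i])
  (tauA_circle : circle tauA)
  (A_tau : superstar beta N tbeta r A / A = ratC tauA)
  (B_tau : - (superstar beta N tbeta r B / B) = ratC tauA)
  (C_tau : - (superstar beta N tbeta r C / C) = ratC tauA)
  (D_tau : superstar beta N tbeta r D / D = ratC tauA)
  (B_neq0 : forall j, (j < N)%N -> reval B (beta j) != 0)
  (g : R[i] -> R[i])
  (g_hol : holomorphic_on_disc g)
  (A_BF : forall z, disc z ->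
     reval A z - reval B z * F z
     = reval (zeta (beta 0%N) * blaschke_pred beta N) z * g z)
  (g_tbeta : forall j, (j <= r)%N -> g (tbeta j) != 0)
  (g_hbeta : forall j, (1 <= j <= n)%N -> g (hbeta j) != 0)
  (f : R[i] -> R[i])
  (f_hol : holomorphic_on_disc f)
  (f_neq0 : exists z, disc z /\ f z != 0)
  (AD_BC : forall z, disc z ->
     reval (A * D - B * C) z
     = reval (zeta (beta 0%N) * blaschke_pred beta N
              * zeta (tbeta 0%N) * blaschke_pred tbeta r) z * f z)
  (tF : R[i] -> R[i])
  (tF_def : forall z, disc z -> reval A z - reval B z * F z != 0 ->
     tF z = (- reval C z + reval D z * F z) / (reval A z - reval B z * F z))
  (tF_C : C_function tF)
  (tF_tbeta0 : tF (tbeta 0%N) = 1)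
  (c : R)
  (c_neq0 : c != 0)
  (G J : ratfun R)
  (G_def : G = (phi * A + psi * B)
               / (ratC c%:C * PN (beta 0%N) (beta N) * blaschke beta N))
  (J_def : J = (phi * C + psi * D)
               / (ratC c%:C * PN (beta 0%N) (beta N) * blaschke beta N))
  (G_neq0 : G != 0)
  (J_neq0 : J != 0) :
  (forall nu : probability (borelC R) R, herglotz (tbeta 0%N) tF nu ->
     perp nu G (Lsp_pred (continued r tbeta hbeta) (r + n)) /\
     second_kind nu (tbeta 0%N) G J) /\
  (forall nu : probability (borelC R) R,
     herglotz (tbeta 0%N) (fun z => (tF z)^-1) nu ->
     perp nu J (Lsp_pred (continued r tbeta hbeta) (r + n)) /\
     second_kind nu (tbeta 0%N) J G).
Proof.
set b := continued N beta hbeta; set tb := continued r tbeta hbeta.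
set k := (N + n)%N; set m := (r + n)%N.
have db : forall j, (j <= k)%N -> disc (b j) by exact: continued_disc.
have dtb : forall j, (j <= m)%N -> disc (tb j) by exact: continued_disc.
have htb0 : hbeta 0%N = tbeta r by rewrite tbeta_r.
have d0 : disc (beta 0%N) by exact: beta_disc.
have dN : disc (beta N) by exact: beta_disc.
have dt0 : disc (tb 0%N) by exact: dtb.
have cF z : disc z -> cont F z by move=> dz; exact: holomorphic_cont F_C.1 dz.
have ctF z : disc z -> cont tF z by move=> dz; exact: holomorphic_cont tF_C.1 dz.
have cf z : disc z -> cont f z by move=> dz; exact: holomorphic_cont dz.
have cg z : disc z -> cont g z by move=> dz; exact: holomorphic_cont dz.
have hF : herglotz (b 0%N) F mu by exact: mu_F.
have psi_def' : second_kind mu (b 0%N) phi psi by exact: psi_def.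
have rLmul x : Lmul (Lsp beta N) (Lsp tbeta r) x ->
    forall z, `|z| <= 1 -> regular x z.
  move=> [u [v [Lu Lv ->]]] z z1.
  by apply: regularM;
    [exact: regular_Lsp beta_disc Lu z1|exact: regular_Lsp tbeta_disc Lv z1].
have [rA rB rC rD] := And4 (rLmul _ A_L) (rLmul _ B_L) (rLmul _ C_L) (rLmul _ D_L).
have rphi z : `|z| <= 1 -> regular phi z by exact: regular_Lsp db phi_L.
have [cpsi dpsi _] := psi_regular db hF cF phi_L psi_def'.
have rpsi z : `|z| <= 1 -> regular psi z.
  move=> z1; have [cz|cz] := pselect (circle z); first exact: cpsi.
  by case: (dpsi z) => //; rewrite /disc/= lt_neqAle z1 andbT; exact/eqP.
pose W := zeta_prod beta N; pose V := zeta_prod tbeta r.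
pose U := W / pair_denominator N beta c.
have rW z : `|z| <= 1 -> regular W z.
  by move=> z1; apply: (reval_zeta_prod _ z1).1 => j /ltnW/beta_disc.
have rU z : `|z| <= 1 -> regular U z by exact: regular_unit_factor.
have disc_in (P : R[i] -> Prop) : (forall z, `|z| <= 1 -> P z) ->
  forall z, disc z -> P z by move=> h z /disc_le1/h.
have hABF z : disc z -> reval A z - reval B z * F z = reval W z * g z.
  by move=> dz; rewrite A_BF// zeta_blaschke_pred.
have hdet z : disc z -> reval (A * D - B * C) z = reval (W * V) z * f z.
  move=> dz; rewrite AD_BC// -(mulrA (zeta _ * _) (zeta _)).
  by rewrite (zeta_blaschke_pred beta) (zeta_blaschke_pred tbeta).
have [h [ch hh]] := phi_factor db hF cF phi_L psi_def' phi_perp.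
have rT i z : disc z -> regular (zeta_prod hbeta i) z.
  by move=> dz; apply: (reval_zeta_prod _ (disc_le1 dz)).1.
have hps z : disc z -> reval phi z * F z + reval psi z =
    reval W z * reval (zeta_prod hbeta n) z * h z.
  move=> dz; rewrite hh// /k /b (zeta_prod_continued _ hbeta0).
  by rewrite (revalM (rW z (disc_le1 dz)) (rT n z dz)).
have [rpsis [h' [ch' hh']]] := superstar_factor db hF cF phi_L psi_def'.
pose Bh := blaschke hbeta n.
have eBk : blaschke b k = blaschke beta N * Bh by exact: blaschke_continued.
pose phis := blaschke beta N * Bh * substar phi.
pose psis := - (blaschke beta N * Bh * substar psi).
have hpss z : disc z -> reval phis z * F z + reval psis z =
    reval W z * reval (zeta_prod hbeta n.+1) z * h' z.
  move=> dz; have := hh' z dz; rewrite eBk => ->.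
  rewrite /k -addnS (zeta_prod_continued _ hbeta0).
  by rewrite (revalM (rW z (disc_le1 dz)) (rT n.+1 z dz)).
have rphis z : disc z -> regular phis z.
  by move=> dz; have := regular_superstar db phi_L (disc_le1 dz); rewrite eBk.
have rpsis' z : disc z -> regular psis z.
  by move=> dz; apply: regularN; have := rpsis z dz; rewrite eBk.
have eG : G = transform N beta U phi psi A B.
  rewrite G_def /transform /U /pair_denominator; apply: quotient_identity.
  exact: zeta_prod_neq0.
have eJ : J = transform N beta U phi psi C D.
  rewrite J_def /transform /U /pair_denominator; apply: quotient_identity.
  exact: zeta_prod_neq0.
have tau0 : tauA != 0 by rewrite -normr_eq0 tauA_circle oner_neq0.
have eBm : blaschke tb m = blaschke tbeta r * Bh by exact: blaschke_continued.
have neg (x : ratfun R) : - (superstar beta N tbeta r x / x) = ratC tauA ->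
    superstar beta N tbeta r x / x = ratC (- tauA).
  move=> /(congr1 -%R); rewrite opprK => ->.
  by rewrite -(rmorphN (@ratC R)).
have eGs : blaschke tb m * substar G = ratC tauA * transform N beta U phis psis A B.
  by rewrite eBm G_def; exact: substar_pair (neg _ B_tau).
have eJs : blaschke tb m * substar J =
    ratC (- tauA) * transform N beta U phis psis C D.
  rewrite eBm J_def; apply: substar_pair => //; first by rewrite oppr_eq0.
    exact: neg.
  by rewrite opprK.
have rGJ x y z : (forall z, `|z| <= 1 -> regular x z) ->
    (forall z, `|z| <= 1 -> regular y z) -> circle z ->
    regular (transform N beta U phi psi x y) z.
  move=> rx ry cz; have z1 := circle_le1 cz.
  apply: regularM.
    apply: regularM; first exact: rU.
    by apply: regularD; apply: regularM;
      [exact: rphi|exact: rx|exact: rpsi|exact: ry].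
  apply: regularV; first exact: rW.
  apply: zeta_prod_nonzero => // [j /ltnW/beta_disc//|j jN].
  by have := circle_neq (beta_disc _ (ltnW jN)) cz; rewrite subr_eq0.
have tG := @transform_AB_regular R N beta F g A B U beta_disc cg (disc_in _ rA)
  (disc_in _ rB) (disc_in _ rU) hABF.
have tJ := @transform_CD_regular R N r beta tbeta F f g A B C D U beta_disc
  tbeta_disc cf cg (disc_in _ rA) (disc_in _ rB) (disc_in _ rC) (disc_in _ rD)
  (disc_in _ rU) hABF hdet B_neq0.
have tP := @transform_pair R N r beta tbeta F tF f g A B C D U beta_disc
  tbeta_disc cg (disc_in _ rA) (disc_in _ rB) (disc_in _ rC) (disc_in _ rD)
  (disc_in _ rU) hABF hdet tF_def.
have in_closed (P : R[i] -> Prop) : (forall z, disc z -> P z) ->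
    (forall z, circle z -> P z) -> forall z, `|z| <= 1 -> P z.
  move=> hd hc z z1; have [cz|cz] := pselect (circle z); first exact: hc.
  by apply: hd; rewrite /disc/= lt_neqAle z1 andbT; exact/eqP.
have rG z : `|z| <= 1 -> regular G z.
  rewrite eG; apply: in_closed => {}z; last exact: rGJ.
  move=> dz; apply: (tG _ _ _ _ (disc_in _ rphi) (disc_in _ rpsi) (rT n) ch hps z dz).1.
have rJ z : `|z| <= 1 -> regular J z.
  rewrite eJ; apply: in_closed => {}z; last exact: rGJ.
  move=> dz; apply: (tJ _ _ _ _ (disc_in _ rphi) (disc_in _ rpsi) (rT n) ch hps z dz).
have rGs z : disc z -> regular (blaschke tb m * substar G) z.
  move=> dz; rewrite eGs; apply: regularM; first by reg.
  exact: (tG _ _ _ _ rphis rpsis' (rT n.+1) ch' hpss z dz).1.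
have rJs z : disc z -> regular (blaschke tb m * substar J) z.
  move=> dz; rewrite eJs; apply: regularM; first by reg.
  exact: (tJ _ _ _ _ rphis rpsis' (rT n.+1) ch' hpss z dz).
(* Near the new nodes g has no zero, so that the quotients by g below are
   continuous there. *)
have gtb j : (j <= m)%N -> g (tb j) != 0.
  rewrite /tb /continued; case: ifPn => [jr _|]; first exact: g_tbeta.
  rewrite -ltnNge => rj jm; apply: g_hbeta.
  by rewrite subn_gt0 rj leq_subLR.
have dtb' j : (j < m)%N -> disc (tb j) by move=> /ltnW/dtb.
pose K z := reval U z * zeta_units tb m z * (h z * f z / g z).
pose K' z := tauA * reval U z * (Defs.eta (tb 0%N) / (1 - conjc (tb 0%N) * z)) *
  (h' z * f z / g z).
have cK j : (j <= m)%N -> cont K (tb j).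
  move=> jm; have dj := dtb j jm; have gj := gtb j jm.
  have := ch _ dj; have := cf _ dj; have := cg _ dj.
  have := cont_reval (rU _ (disc_le1 dj)); have := cont_zeta_units dtb' dj => *.
  by rewrite /K; conts.
have cK' j : (j <= m)%N -> cont K' (tb j).
  move=> jm; have dj := dtb j jm; have gj := gtb j jm.
  have := ch' _ dj; have := cf _ dj; have := cg _ dj.
  have vj := varpi_neq0 dt0 (disc_le1 dj); rewrite horner_varpi in vj.
  by have := cont_reval (rU _ (disc_le1 dj)) => *; rewrite /K'; conts.
have rV z : disc z -> regular V z.
  by move=> dz; apply: (reval_zeta_prod _ (disc_le1 dz)).1 => j /ltnW/tbeta_disc.
(* The zeros of V and the points hbeta 0, ..., hbeta (n - 1) together make up
   tb 0, ..., tb (m - 1), because tbeta r = hbeta 0. *)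
have hK j : (j <= m)%N -> around (tb j) (fun z =>
    reval G z * tF z + reval J z = (\prod_(0 <= i < m) (z - tb i)) * K z).
  move=> jm; have dj := dtb j jm.
  have := tP _ _ _ _ (disc_in _ rphi) (disc_in _ rpsi) hps _ dj (gtb j jm).
  rewrite -eG -eJ => /(around_and (around_disc dj)).
  apply: around_mono => z [dz ->].
  have [_ e] := reval_zeta_prod dtb' (disc_le1 dz).
  have := e; rewrite {1}/m {1}/tb (zeta_prod_continued _ htb0).
  rewrite (revalM (rV z dz) (rT n z dz)).
  move=> e'; rewrite -[_ * reval V z * _]mulrA e' /K; ring.
have hK' j : (j <= m)%N -> around (tb j) (fun z =>
    reval (substar G) z * tF z - reval (substar J) z = (z - tb 0%N) * K' z).
  move=> jm; have dj := dtb j jm.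
  have := tP _ _ _ _ rphis rpsis' hpss _ dj (gtb j jm).
  move=> /(around_and (around_disc dj)).
  move=> /(around_and (around_regular (substar G) _)).
  move=> /(around_and (around_regular (substar J) _)).
  move=> /(around_and (around_almost _ (almost_neq0 (blaschke_neq0 tb m)))).
  apply: around_mono => z [nB [rJz [rGz [dz e]]]].
  have rB' : regular (blaschke tb m) z.
    rewrite blaschkeE; apply: regular_prod => i /andP[_ im].
    by apply: regular_zeta; [exact: dtb|exact: disc_le1].
  have rG0 := (tG _ _ _ _ rphis rpsis' (rT n.+1) ch' hpss z dz).1.
  have rJ0 := tJ _ _ _ _ rphis rpsis' (rT n.+1) ch' hpss z dz.
  apply: (mulfI nB).
  have := congr1 (fun x => reval x z) eGs.
  rewrite /= (revalM rB' rGz) (revalM (regular_ratC _ _) rG0) reval_ratC => eGz.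
  have := congr1 (fun x => reval x z) eJs.
  rewrite /= (revalM rB' rJz) (revalM (regular_ratC _ _) rJ0) reval_ratC => eJz.
  rewrite mulrBr mulrA eGz eJz mulNr opprK -mulrA -mulrDr e.
  have vz := varpi_neq0 dt0 (disc_le1 dz).
  have [rz ez] := reval_zeta vz.
  have eVT : reval V z * reval (zeta_prod hbeta n.+1) z =
      reval (zeta (tb 0%N)) z * reval (blaschke tb m) z.
    rewrite -(revalM (rV z dz) (rT n.+1 z dz)) -(revalM rz rB').
    by rewrite -(zeta_prod_continued _ htb0) zeta_blaschke addnS.
  by rewrite -[_ * reval V z * _]mulrA eVT ez /K'; ring.
split=> nu hnu.
  exact: (perp_second_kind dtb hnu ctF rG rJ rGs rJs cK cK' hK hK').
(* For 1 / tF the roles of G and J are exchanged, and both interpolation conditions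
   are divided by tF, which has no zero. *)
have tF0 z : disc z -> tF z != 0.
  by move=> dz; have := tF_C.2 z dz; apply: contraTneq => ->; rewrite ltxx.
pose tFi z := (tF z)^-1; pose L z := K z / tF z; pose L' z := - K' z / tF z.
have ctFi z : disc z -> cont tFi z.
  by move=> dz; have := ctF z dz; have := tF0 z dz => *; rewrite /tFi; conts.
have cL j : (j <= m)%N -> cont L (tb j).
  move=> jm; have dj := dtb j jm; rewrite /L.
  by have := ctF _ dj; have := tF0 _ dj; have := cK j jm => *; conts.
have cL' j : (j <= m)%N -> cont L' (tb j).
  move=> jm; have dj := dtb j jm; rewrite /L'.
  by have := ctF _ dj; have := tF0 _ dj; have := cK' j jm => *; conts.
have hL j : (j <= m)%N -> around (tb j) (fun z =>
    reval J z * tFi z + reval G z = (\prod_(0 <= i < m) (z - tb i)) * L z).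
  move=> jm; apply: around_mono (around_and (around_disc (dtb j jm)) (hK j jm)).
  move=> z [dz e]; have t0 := tF0 z dz.
  by rewrite /L mulrA -e /tFi; field.
have hL' j : (j <= m)%N -> around (tb j) (fun z =>
    reval (substar J) z * tFi z - reval (substar G) z = (z - tb 0%N) * L' z).
  move=> jm; apply: around_mono (around_and (around_disc (dtb j jm)) (hK' j jm)).
  move=> z [dz e]; have t0 := tF0 z dz.
  by rewrite /L' mulrA mulrN -e /tFi; field.
exact: (perp_second_kind dtb hnu ctFi rJ rG rJs rGs cL cL' hL hL').
Qed.
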